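(* Let $q<0$ be a real number and let $K,L\subset\mathbb{R}^n$ be two convex bodies that contain the origin in their interiors. If $\widetilde{C}_q(K,\cdot)=\widetilde{C}_q(L,\cdot)$ (equality of Borel measures on $S^{n-1}$), then $K=L$.
   Context: Work in $\mathbb{R}^n$ with the standard inner product $x\cdot y$; $S^{n-1}$ is the unit sphere, and $du$ denotes integration with respect to spherical Lebesgue measure, i.e. $(n-1)$-dimensional Hausdorff measure $\mathcal{H}^{n-1}$, on $S^{n-1}$. A convex body is a compact convex subset of $\mathbb{R}^n$ with non-empty interior; $\mathcal{K}_o^n$ is the set of convex bodies containing the origin in their interior. For $K\in\mathcal{K}_o^n$, the support function is $h_K(v)=\max\{v\cdot x:x\in K\}$ and the radial function is $\rho_K(u)=\max\{\lambda>0:\lambda u\in K\}$, for $u,v\in S^{n-1}$. A unit vector $v$ is an outer unit normal of $K$ at $x\in\partial K$ if $x\cdot v=h_K(v)$. For $\eta\subset S^{n-1}$, the reverse radial Gauss image is $$\vec{\alpha}_K^*(\eta)=\{u\in S^{n-1}: \text{some } v\in\eta \text{ is an outer unit normal of } K \text{ at } \rho_K(u)u\}.$$ For $q\in\mathbb{R}$, the $q$-th dual curvature measure of $K\in\mathcal{K}_o^n$ is the finite Borel measure on $S^{n-1}$ given, for Borel $\eta\subset S^{n-1}$, by $$\widetilde{C}_q(K,\eta)=\frac1n\int_{\vec{\alpha}_K^*(\eta)}\rho_K^q(u)\,du.$$ (For Borel $\eta$ the set $\vec{\alpha}_K^*(\eta)$ is spherical Lebesgue measurable.) *)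

(* Defs.v *)
From HB Require Import structures.
From mathcomp Require Import all_boot all_order all_algebra.
From mathcomp Require Import all_classical all_reals all_analysis.

Set Implicit Arguments.
Unset Strict Implicit.
Unset Printing Implicit Defensive.

Import Order.TTheory GRing.Theory Num.Theory.
Import numFieldNormedType.Exports.

Local Open Scope classical_set_scope.
Local Open Scope ring_scope.

(* The library norm on ['rV[R]_n] is the sup norm, so the Euclidean inner
   product and norm are introduced here; the two norms induce the same topology,
   and [compact], [open], [closure] and interior below are the library's. *)
Definition dotv (R : realType) (n : nat) (x y : 'rV[R]_n) : R :=
  \sum_(i < n) x 0 i * y 0 i.

Definition enorm (R : realType) (n : nat) (x : 'rV[R]_n) : R :=
  Num.sqrt (dotv x x).

Definition sphere (R : realType) (n : nat) : set 'rV[R]_n :=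
  [set u | enorm u = 1].
Arguments sphere : clear implicits.

Definition borel_sphere (R : realType) (n : nat) : set (set 'rV[R]_n) :=
  <<s sphere R n, [set U `&` sphere R n | U in open] >>.
Arguments borel_sphere : clear implicits.

Section Hausdorff.
Context (R : realType) (n : nat).
Local Open Scope ereal_scope.
Implicit Types A U : set 'rV[R]_n.

Definition ediam U : \bar R :=
  ereal_sup [set (enorm (p.1 - p.2)%R)%:E | p in U `*` U].

(* The volume [pi^(m/2) / Gamma(m/2 + 1)] of the unit ball of R^m. *)
Fixpoint unit_ball_volume (m : nat) : R :=
  match m with
  | 0 => 1%R
  | 1 => 2%R
  | k.+2 => (2 * pi / k.+2%:R * unit_ball_volume k)%R
  end.

(* The case split makes the empty set weigh 0 also for [m = 0]; on nonempty sets
   [ediam U ^+ 0 = 1], so that the measure of dimension 0 is counting measure. *)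
Definition diam_weight (m : nat) U : \bar R :=
  if `[< U = set0 >] then 0
  else (unit_ball_volume m)%:E * ((2^-1)%:E * ediam U) ^+ m.

Definition hausdorff_content (m : nat) (delta : R) A : \bar R :=
  ereal_inf [set \sum_(i <oo) diam_weight m (F i) |
    F in [set F : (set 'rV[R]_n)^nat |
           A `<=` \bigcup_i F i /\ forall i, ediam (F i) <= delta%:E]].

(* The normalization by [unit_ball_volume] makes this the usual
   m-dimensional volume on m-dimensional submanifolds of R^n. *)
Definition hausdorff (m : nat) A : \bar R :=
  ereal_sup [set hausdorff_content m delta A |
    delta in [set delta : R | (0 < delta)%R]].

Lemma ediam_ge0 U : U !=set0 -> 0 <= ediam U.
Proof.
move=> [x Ux]; apply: (@le_trans _ _ (enorm (x - x)%R)%:E).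
  by rewrite lee_fin sqrtr_ge0.
by apply: ereal_sup_ubound; exists (x, x).
Qed.

Lemma ediam0 : ediam set0 = -oo.
Proof.
by rewrite /ediam setX0 image_set0 ereal_sup0.
Qed.

Lemma unit_ball_volume_ge0 m : (0 <= unit_ball_volume m)%R.
Proof.
elim/ltn_ind: m => -[|[|m]] IH //=.
by rewrite mulr_ge0 ?IH // divr_ge0 // mulr_ge0 // pi_ge0.
Qed.

Lemma diam_weight0 m : diam_weight m set0 = 0.
Proof. by rewrite /diam_weight; case: asboolP. Qed.

Lemma diam_weight_ge0 m U : 0 <= diam_weight m U.
Proof.
rewrite /diam_weight; case: asboolP => // /eqP/set0P U0.
rewrite mule_ge0 ?lee_fin ?unit_ball_volume_ge0 // expe_ge0 // mule_ge0 //.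
exact: ediam_ge0.
Qed.

(* [hausdorff_content] as an instance of the library's covering construction. *)
Let T := g_sigma_algebraType [set: set 'rV[R]_n].
Let w m (delta : R) (U : set T) : \bar R :=
  if ediam U <= delta%:E then diam_weight m U else +oo.

Let w_ge0 m delta U : 0 <= w m delta U.
Proof. by rewrite /w; case: ifP => // _; exact: diam_weight_ge0. Qed.

Let w0 m delta : w m delta set0 = 0.
Proof. by rewrite /w ediam0 leNye diam_weight0. Qed.

Let contentE m delta : hausdorff_content m delta = mu_ext (w m delta).
Proof.
apply/funext => A; apply/eqP; rewrite eq_le; apply/andP; split.
  apply: le_ereal_inf_tmp => _ [F [_ AF] <-].
  have [FD|] := pselect (forall i, ediam (F i) <= delta%:E).
    apply: ereal_inf_lbound; exists F => //.
    by apply: eq_eseriesr => i _; rewrite /w FD.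
  move=> /existsNP[i /negP FD].
  rewrite (@nneseries_pinfty _ _ xpredT i) ?leey //.
  by rewrite /w (negbTE FD).
apply: le_ereal_inf_tmp => _ [F [AF FD] <-]; apply: ereal_inf_lbound; exists F.
  by split => // i; exact: sub_sigma_algebra.
by apply: eq_eseriesr => i _; rewrite /w FD.
Qed.

Lemma hausdorff0 m : hausdorff m set0 = 0.
Proof.
apply/eqP; rewrite eq_le; apply/andP; split.
  by apply: ge_ereal_sup => _ [d _ <-]; rewrite contentE mu_ext0.
apply: (@le_trans _ _ (hausdorff_content m 1 set0)).
  by rewrite contentE mu_ext0.
by apply: ereal_sup_ubound; exists 1%R => //=.
Qed.

Lemma hausdorff_ge0 m A : 0 <= hausdorff m A.
Proof.
apply: (@le_trans _ _ (hausdorff_content m 1 A)).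
  by rewrite contentE mu_ext_ge0.
by apply: ereal_sup_ubound; exists 1%R => //=.
Qed.

Lemma le_hausdorff m : {homo hausdorff m : A B / A `<=` B >-> A <= B}.
Proof.
move=> A B AB; apply: ge_ereal_sup => _ [d d0 <-].
apply: (@le_trans _ _ (hausdorff_content m d B)).
  by rewrite contentE le_mu_ext.
by apply: ereal_sup_ubound; exists d.
Qed.

Lemma hausdorff_sigma_subadditive m : sigma_subadditive (hausdorff m).
Proof.
move=> F; apply: ge_ereal_sup => _ [d d0 <-].
apply: (@le_trans _ _ (\sum_(i <oo) hausdorff_content m d (F i))).
  by rewrite contentE mu_ext_sigma_subadditive.
apply: lee_nneseries => [i _ _|i _]; first by rewrite contentE mu_ext_ge0.
by apply: ereal_sup_ubound; exists d.
Qed.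

HB.instance Definition _ (m : nat) := isOuterMeasure.Build R 'rV[R]_n
  (hausdorff m) (hausdorff0 m) (hausdorff_ge0 m) (@le_hausdorff m)
  (@hausdorff_sigma_subadditive m).

End Hausdorff.

(* The measure lives on the Caratheodory sigma-algebra, which contains the Borel
   sets and is complete: the sets integrated over below need not be Borel. *)
Definition hausdorff_measure (R : realType) (n m : nat) :
    {measure set (caratheodory_type (@hausdorff R n m)) -> \bar R} :=
  let mu : {outer_measure set 'rV[R]_n -> \bar R} := @hausdorff R n m in
  [the measure _ _ of (mu : set (caratheodory_type mu) -> \bar R)].
Arguments hausdorff_measure : clear implicits.

Section ConvexBody.
Context (R : realType) (n : nat).
Implicit Types (K : set 'rV[R]_n) (eta : set 'rV[R]_n).

Definition convex_body K := [/\ compact K, convex_set K & K° !=set0].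

(* For a convex body with 0 in its interior, the suprema in the next two
   definitions are attained, by compactness. *)
Definition support_fun K (v : 'rV[R]_n) : R := sup [set dotv v x | x in K].

Definition radial_fun K (u : 'rV[R]_n) : R :=
  sup [set lambda : R | 0 < lambda /\ K (lambda *: u)].

Definition outer_unit_normal K (x v : 'rV[R]_n) :=
  [/\ sphere R n v, (closure K `\` K°) x & dotv x v = support_fun K v].

Definition reverse_radial_gauss_image K eta : set 'rV[R]_n :=
  [set u | sphere R n u /\
    exists2 v, eta v & outer_unit_normal K (radial_fun K u *: u) v].

Definition dual_curvature_measure (q : R) K eta : \bar R :=
  ((n%:R^-1)%:E * \int[hausdorff_measure R n n.-1]_(u in reverse_radial_gauss_image K eta)
      (radial_fun K u `^ q)%:E)%E.

End ConvexBody.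

(* Main.v *)
Require Import Defs.
From mathcomp Require Import all_boot all_order all_algebra.
From mathcomp Require Import all_classical all_reals all_analysis.
From mathcomp Require Import measurable_realfun.
From mathcomp Require Import ring lra zify.
Import Order.TTheory GRing.Theory Num.Theory.
Import numFieldNormedType.Exports.
Local Open Scope classical_set_scope.
Local Open Scope ring_scope.

Set Implicit Arguments.
Unset Strict Implicit.
Unset Printing Implicit Defensive.

(** Suppose [K] is not contained in [L]. Let [U] be the set of directions [u]
    with [rho_K u > rho_L u], a nonempty relatively open subset of the sphere,
    and let [eta] be the open set of normals [v] with [h_K v > h_L v]. Comparing
    [x . v <= h v] at the boundary points [rho_K u u] and [rho_L u u] gives
    [alpha*_K eta `<=` U `<=` alpha*_L eta]; the second inclusion needs an outer
    normal of [L] at every boundary point. Since [q < 0],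
    [rho_K^q < rho_L^q] on [U], hence
    [C_q(K, eta) <= int_U rho_K^q / n < int_U rho_L^q / n <= C_q(L, eta)],
    where strictness uses that [U] has positive and finite Hausdorff measure.
    On the sphere [1 / rho_K] is the gauge of [K]. It is sublinear, so that
    Hahn-Banach provides the normals, and Lipschitz, so that Caratheodory's
    criterion for metric outer measures makes [U] and [rho_K] measurable. *)

(** * Hahn-Banach for sublinear functions *)

Definition sublinear (R : realType) (V : lmodType R) (p : V -> R) :=
  (forall x y, p (x + y) <= p x + p y) /\
  (forall (t : R) x, 0 <= t -> p (t *: x) = t * p x).

Section Sublinear.
Context (R : realType).

Lemma sublinear0 (V : lmodType R) (p : V -> R) : sublinear p -> p 0 = 0.
Proof. by move=> [_ pZ]; rewrite -(scale0r 0) pZ// mul0r. Qed.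

Lemma sublinear_ge_opp (V : lmodType R) (p : V -> R) x :
  sublinear p -> - p (- x) <= p x.
Proof.
move=> sp; have [pD _] := sp; have := pD x (- x).
by rewrite subrr (sublinear0 sp); lra.
Qed.

(* The largest sublinear minorant of [p] that is linear along [e] with slope
   [p e]: [p' x = inf_(t >= 0) (p (x + t e) - t p e)]. *)
Lemma sublinear_linearize (V : lmodType R) (p : V -> R) (e : V) :
  sublinear p ->
  exists p', [/\ sublinear p', forall x, p' x <= p x & p' (- e) <= - p e].
Proof.
move=> sp; have [pD pZ] := sp.
pose S x := [set p (x + t *: e) - t * p e | t in [set t : R | 0 <= t]].
pose p' x := inf (S x).
have S0 x : S x !=set0 by exists (p (x + 0 *: e) - 0 * p e), 0 => //=.
have lbS x : has_lbound (S x).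
  exists (- p (- x)) => _ [t /= t0 <-].
  have := pD (x + t *: e) (- x).
  by rewrite addrAC subrr add0r pZ//; lra.
have p'le x t : 0 <= t -> p' x <= p (x + t *: e) - t * p e.
  by move=> t0; apply: ge_inf => //; exists t.
have p'ge x m : (forall t, 0 <= t -> m <= p (x + t *: e) - t * p e) -> m <= p' x.
  by move=> H; apply: lb_le_inf => // _ [t /= t0 <-]; exact: H.
exists p'; split; last 2 first.
- by move=> x; apply: le_trans (p'le x 0 _) _; rewrite ?scale0r ?addr0 ?mul0r ?subr0.
- by apply: le_trans (p'le _ 1 _) _; rewrite // scale1r addNr (sublinear0 sp) mul1r sub0r.
split => [x y|t x t0].
  (* The two infima are taken one at a time: over [t] for fixed [s], then over [s]. *)
  suff H : forall s, 0 <= s -> p' (x + y) - (p (y + s *: e) - s * p e) <= p' x.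
    have : p' (x + y) - p' x <= p' y.
      by apply: p'ge => s s0; have := H s s0; lra.
    by lra.
  move=> s s0; apply: p'ge => t t0.
  have := p'le (x + y) (t + s) (addr_ge0 t0 s0).
  have := pD (x + t *: e) (y + s *: e).
  by rewrite scalerDl addrACA mulrDl; lra.
(* One inequality suffices: applied to [t^-1] and [t *: x] it gives the converse. *)
have hom : forall (c : R) z, 0 < c -> p' (c *: z) <= c * p' z.
  move=> c z c0; rewrite -ler_pdivrMl//; apply: p'ge => s s0.
  rewrite ler_pdivrMl//; apply: le_trans (p'le _ (c * s) _) _.
    by rewrite mulr_ge0// ltW.
  by rewrite -scalerA -scalerDr pZ ?(ltW c0)// mulrBr mulrA.
move: t0; rewrite le_eqVlt => /predU1P[<-|t0].
  rewrite scale0r mul0r; apply/le_anti/andP; split.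
    by apply: le_trans (p'le 0 0 _) _; rewrite // scale0r addr0 (sublinear0 sp) mul0r subr0.
  by apply: p'ge => s s0; rewrite add0r pZ// subrr.
apply/le_anti/andP; split; first exact: hom.
rewrite -ler_pdivlMl//; have := hom t^-1 (t *: x).
by rewrite scalerA mulVf ?gt_eqF// scale1r; apply; rewrite invr_gt0.
Qed.

(** Directions can be treated one after another, because a smaller sublinear function stays linear
    where the larger one was: [p2 (- x) <= p1 (- x) <= - p1 x <= - p2 x]. *)
Lemma sublinear_linearize_seq (V : lmodType R) (p : V -> R) (s : seq V) :
  sublinear p ->
  exists p', [/\ sublinear p', forall x, p' x <= p x &
    forall e, e \in s -> p' (- e) <= - p' e].
Proof.
move=> sp; elim: s => [|e s [p1 [sp1 p1p p1s]]]; first by exists p.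
have [p2 [sp2 p2p1 p2e]] := sublinear_linearize e sp1.
exists p2; split => // [x|x]; first exact: le_trans (p2p1 x) _.
rewrite inE => /predU1P[->|xs].
  by apply: le_trans p2e _; rewrite lerN2.
have := p1s x xs; have := p2p1 x; have := p2p1 (- x).
by lra.
Qed.

(** Linearizing first along [u] and then along every basis vector leaves a sublinear [p2] bounded
    above by [dotv x w], where [w] lists its values on the basis. The same bound at [- x] gives
    equality. *)
Lemma hahn_banach_sublinear n (p : 'rV[R]_n -> R) (u : 'rV[R]_n) :
  sublinear p ->
  exists w, (forall x, dotv x w <= p x) /\ dotv u w = p u.
Proof.
move=> sp.
have [p1 [sp1 p1p p1u]] := sublinear_linearize u sp.
have [p2 [sp2 p2p1 p2e]] :=
  sublinear_linearize_seq [seq delta_mx 0 i | i <- enum 'I_n] sp1.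
have [p2D p2Z] := sp2.
pose w : 'rV[R]_n := \row_i p2 (delta_mx 0 i).
have p2Zd (c : R) (i : 'I_n) : p2 (c *: delta_mx 0 i) <= c * p2 (delta_mx 0 i).
  have [c0|c0] := leP 0 c; first by rewrite p2Z.
  rewrite -[c]opprK scaleNr -scalerN p2Z ?oppr_ge0 ?(ltW c0)//.
  rewrite [leRHS]mulNr -mulrN ler_wpM2l ?oppr_ge0 ?(ltW c0)//.
  by apply: p2e; apply: map_f; rewrite mem_enum.
have p2w x : p2 x <= dotv x w.
  rewrite {1}(row_sum_delta x) /dotv.
  elim/big_ind2 : _ => [|a b c d ab cd|i _].
  - by rewrite (sublinear0 sp2).
  - by apply: le_trans (p2D _ _) _; apply: lerD.
  - by rewrite [w _ _]mxE.
have dotN x : dotv (- x) w = - dotv x w.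
  by rewrite /dotv -sumrN; apply: eq_bigr => i _; rewrite mxE mulNr.
have p2E x : p2 x = dotv x w.
  apply/le_anti/andP; split => //.
  have := p2w (- x); have := sublinear_ge_opp x sp2.
  by rewrite dotN; lra.
exists w; split => [x|]; first by rewrite -p2E (le_trans (p2p1 x)).
rewrite -p2E; apply/le_anti/andP; split; first by rewrite (le_trans (p2p1 u)).
(* The value at [u] survives the later steps: [p2 u >= - p2 (- u) >= - p1 (- u) >= p u]. *)
have := sublinear_ge_opp u sp2.
by have := p2p1 (- u); lra.
Qed.

End Sublinear.

(** * Gauge, radial and support functions *)

Section EuclideanVectors.
Context (R : realType) (n : nat).
Implicit Types x y u v : 'rV[R]_n.

Lemma dotvC x y : dotv x y = dotv y x.
Proof. by apply: eq_bigr => i _; rewrite mulrC. Qed.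

Lemma dotvDl x y v : dotv (x + y) v = dotv x v + dotv y v.
Proof. by rewrite /dotv -big_split; apply: eq_bigr => i _; rewrite mxE mulrDl. Qed.

Lemma dotvZl (c : R) x v : dotv (c *: x) v = c * dotv x v.
Proof. by rewrite /dotv mulr_sumr; apply: eq_bigr => i _; rewrite mxE mulrA. Qed.

Lemma dotvNl x v : dotv (- x) v = - dotv x v.
Proof. by rewrite -scaleN1r dotvZl mulN1r. Qed.

Lemma dotvDr x y v : dotv v (x + y) = dotv v x + dotv v y.
Proof. by rewrite dotvC dotvDl !(dotvC v). Qed.

Lemma dotvZr (c : R) x v : dotv v (c *: x) = c * dotv v x.
Proof. by rewrite dotvC dotvZl dotvC. Qed.

Lemma dotvNr x v : dotv v (- x) = - dotv v x.
Proof. by rewrite dotvC dotvNl dotvC. Qed.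

Lemma dotvv_ge0 x : 0 <= dotv x x.
Proof. by apply: sumr_ge0 => i _; rewrite -expr2 sqr_ge0. Qed.

Lemma enorm_ge0 x : 0 <= enorm x.
Proof. exact: sqrtr_ge0. Qed.

Lemma sqr_enorm x : enorm x ^+ 2 = dotv x x.
Proof. by rewrite sqr_sqrtr// dotvv_ge0. Qed.

Lemma enormZ (c : R) x : enorm (c *: x) = `|c| * enorm x.
Proof.
by rewrite /enorm dotvZl dotvZr mulrA -expr2 sqrtrM ?sqr_ge0// sqrtr_sqr.
Qed.

Lemma sphereP u : sphere R n u <-> dotv u u = 1.
Proof.
rewrite /sphere/=; split=> [u1|u1]; first by rewrite -sqr_enorm u1 expr1n.
by rewrite /enorm u1 sqrtr1.
Qed.

Lemma sphere_dotv u : sphere R n u -> dotv u u = 1.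
Proof. by move/sphereP. Qed.

Lemma coord_le_norm x i : `|x 0 i| <= `|x|.
Proof.
have -> : `|x| = mx_norm x by [].
rewrite mx_normrE.
exact: (le_bigmax _ (fun ij : 'I_1 * 'I_n => `|x ij.1 ij.2|) (0, i)).
Qed.

Lemma norm_le_coord x (c : R) : 0 <= c -> (forall i, `|x 0 i| <= c) -> `|x| <= c.
Proof.
move=> c0 xc; have -> : `|x| = mx_norm x by [].
rewrite mx_normrE; apply/bigmax_leP; split=> // -[i j] _ /=.
by rewrite (ord1 i).
Qed.

Lemma coord_le_enorm x i : `|x 0 i| <= enorm x.
Proof.
rewrite -(ler_pXn2r (ltn0Sn 1)) ?nnegrE ?enorm_ge0// sqr_enorm real_normK ?num_real//.
rewrite /dotv (bigD1 i)//= -expr2 lerDl; apply: sumr_ge0 => j _.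
by rewrite -expr2 sqr_ge0.
Qed.

Lemma norm_le_enorm x : `|x| <= enorm x.
Proof. by apply: norm_le_coord => [|i]; [exact: enorm_ge0|exact: coord_le_enorm]. Qed.

Lemma enorm_le_coord x (c : R) :
  0 <= c -> (forall i, `|x 0 i| <= c) -> enorm x <= n%:R * c.
Proof.
move=> c0 xc.
rewrite -(ler_pXn2r (ltn0Sn 1)) ?nnegrE ?enorm_ge0 ?mulr_ge0// sqr_enorm.
have [n0|n0] := eqVneq n 0%N.
  rewrite /dotv big1 ?sqr_ge0// => i _.
  by exfalso; case: i => m; rewrite n0.
apply: (@le_trans _ _ (\sum_(i < n) c ^+ 2)).
  apply: ler_sum => i _; rewrite -expr2 -real_normK ?num_real//.
  by rewrite ler_pXn2r ?nnegrE.
rewrite sumr_const card_ord exprMn -[_ *+ n]mulr_natl ler_wpM2r ?sqr_ge0//.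
by rewrite -natrX ler_nat leq_pmulr ?lt0n.
Qed.

Lemma dotv_le_norm x y : `|dotv x y| <= n%:R * (`|x| * `|y|).
Proof.
apply: le_trans (ler_norm_sum _ _ _) _.
apply: (@le_trans _ _ (\sum_(i < n) `|x| * `|y|)).
  by apply: ler_sum => i _; rewrite normrM ler_pM ?coord_le_norm.
by rewrite sumr_const card_ord mulr_natl.
Qed.

Lemma norm_sphere_le1 u : sphere R n u -> `|u| <= 1.
Proof. by move=> u1; apply: le_trans (norm_le_enorm u) _; rewrite u1. Qed.

Lemma sphere_neq0 u : sphere R n u -> u != 0.
Proof.
move=> /sphere_dotv; apply: contra_eq_neq => ->.
by rewrite -(scale0r 0) dotvZl mul0r eq_sym oner_neq0.
Qed.

Lemma enorm_gt0 x : x != 0 -> 0 < enorm x.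
Proof. by move=> x0; apply: lt_le_trans (norm_le_enorm x); rewrite normr_gt0. Qed.

Lemma sphere_normalize x : x != 0 -> sphere R n ((enorm x)^-1 *: x).
Proof.
move=> x0; have := enorm_gt0 x0 => xp.
by rewrite /sphere/= enormZ ger0_norm ?invr_ge0 ?enorm_ge0// mulVf// gt_eqF.
Qed.

End EuclideanVectors.

(** * The Minkowski functional of a convex body *)

Definition gauge (R : realType) (n : nat) (K : set 'rV[R]_n) (x : 'rV[R]_n) : R :=
  inf [set t | 0 < t /\ K (t^-1 *: x)].

Section Gauge.
Context (R : realType) (n : nat).
Implicit Types (K L : set 'rV[R]_n) (x y u v : 'rV[R]_n).

Lemma interior0_ball K : K° 0 -> exists2 r, 0 < r & forall x, `|x| < r -> K x.
Proof.
move=> /nbhs_ballP[r /= r0 rK]; exists r => // x xr; apply: rK.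
by rewrite -ball_normE /= sub0r normrN.
Qed.

Lemma convex_body_bounded K :
  convex_body K -> exists2 M, 0 < M & forall x, K x -> `|x| <= M.
Proof.
move=> [/compact_bounded [M [_ KM]] _ _]; exists (`|M| + 1).
  by rewrite ltr_wpDl.
by move=> x Kx; apply: KM => //; rewrite ltr_pwDr// ler_norm.
Qed.

Lemma convex_body_conv K x y (l : R) : convex_body K -> K x -> K y ->
  0 < l -> l < 1 -> K (l *: x + (1 - l) *: y).
Proof.
move=> [_ cK _] Kx Ky l0 l1; have /convex_setW := cK => /(_ x y).
rewrite !inE => H.
have := H Kx Ky (Itv01 (ltW l0) (ltW l1)).
by rewrite inE; apply.
Qed.

Section Body.
Variable K : set 'rV[R]_n.
Hypotheses (bK : convex_body K) (oK : K° 0).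

Let gset x := [set t : R | 0 < t /\ K (t^-1 *: x)].

Let K0 : K 0. Proof. exact: interior_subset. Qed.

Let gset_lb x : has_lbound (gset x).
Proof. by exists 0 => t [/ltW]. Qed.

Let gset_n0 x : gset x !=set0.
Proof.
have [r r0 rK] := interior0_ball oK; exists ((`|x| + 1) / r).
have t0 : 0 < (`|x| + 1) / r by rewrite divr_gt0// ltr_wpDl.
split => //; apply: rK; rewrite normrZ gtr0_norm ?invr_gt0//.
by rewrite invf_div mulrAC ltr_pdivrMr ?ltr_wpDl// ltr_pM2l// ltrDl.
Qed.

Lemma gauge_ge0 x : 0 <= gauge K x.
Proof. by apply: lb_le_inf => [|t [/ltW]//]; exact: gset_n0. Qed.

Lemma gauge_le x (t : R) : 0 < t -> K (t^-1 *: x) -> gauge K x <= t.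
Proof. by move=> t0 Kt; apply: ge_inf => //; exact: gset_lb. Qed.

(** Some [t < s] has [t^-1 *: x] in [K], and [s^-1 *: x] lies on the segment from the origin to that
    point. *)
Lemma gauge_lt x (s : R) : gauge K x < s -> K (s^-1 *: x).
Proof.
move=> xs; have [t [t0 Kt] ts] := inf_lt (gset_n0 x) xs.
have s0 : 0 < s := lt_trans t0 ts.
have -> : s^-1 *: x = (t / s) *: (t^-1 *: x) + (1 - t / s) *: (0 : 'rV[R]_n).
  by rewrite scaler0 addr0 scalerA mulrAC divff ?gt_eqF// mul1r.
by apply: convex_body_conv => //; rewrite ?divr_gt0// ltr_pdivrMr// mul1r.
Qed.

(** For [s] and [t] slightly above the two gauges, [(s + t)^-1 *: (x + y)] is the convex combination
    of [s^-1 *: x] and [t^-1 *: y] with weights [s / (s + t)] and [t / (s + t)]. *)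
Lemma gauge_sublinear : sublinear (gauge K).
Proof.
have sub x y : gauge K (x + y) <= gauge K x + gauge K y.
  apply/ler_addgt0Pr => e e0; have e2 : 0 < e / 2 by rewrite divr_gt0.
  set s := gauge K x + e / 2; set t := gauge K y + e / 2.
  have s0 : 0 < s by rewrite ltr_wpDl// gauge_ge0.
  have t0 : 0 < t by rewrite ltr_wpDl// gauge_ge0.
  have -> : gauge K x + gauge K y + e = s + t by rewrite /s /t; lra.
  have st0 : 0 < s + t by rewrite addr_gt0.
  apply: gauge_le => //.
  have -> : (s + t)^-1 *: (x + y) =
      (s / (s + t)) *: (s^-1 *: x) + (1 - s / (s + t)) *: (t^-1 *: y).
    rewrite !scalerA scalerDr; congr (_ *: _ + _ *: _).
      by field; rewrite !gt_eqF.
    by field; rewrite !gt_eqF.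
  apply: convex_body_conv => //.
  - by apply: gauge_lt; rewrite ltrDl.
  - by apply: gauge_lt; rewrite ltrDl.
  - by rewrite divr_gt0.
  - by rewrite ltr_pdivrMr// mul1r ltrDl.
have hom x (c : R) : 0 < c -> gauge K (c *: x) <= c * gauge K x.
  move=> c0; apply/ler_addgt0Pr => e e0.
  have -> : c * gauge K x + e = c * (gauge K x + e / c).
    by rewrite mulrDr mulrCA divff ?gt_eqF// mulr1.
  have ec : 0 < e / c by rewrite divr_gt0.
  apply: gauge_le; first by rewrite mulr_gt0// ltr_wpDl// gauge_ge0.
  rewrite invfM scalerA mulrAC mulVf ?gt_eqF// mul1r; apply: gauge_lt.
  by rewrite ltrDl.
split=> // t x; rewrite le_eqVlt => /predU1P[<-|t0].
  rewrite scale0r mul0r; apply/le_anti; rewrite gauge_ge0 andbT.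
  by apply/ler_addgt0Pr => z z0; rewrite add0r; apply: gauge_le; rewrite ?scaler0.
apply/le_anti/andP; split; first exact: hom.
rewrite -ler_pdivlMl//.
have := hom (t *: x) t^-1; rewrite scalerA mulVf ?gt_eqF// scale1r; apply.
by rewrite invr_gt0.
Qed.

Lemma gaugeZ (t : R) x : 0 <= t -> gauge K (t *: x) = t * gauge K x.
Proof. by have [_] := gauge_sublinear; exact. Qed.

(** A ball of radius [r] inside [K] bounds the gauge by [2 / r] times the norm, and subadditivity
    turns this into a Lipschitz bound. The factor 2 keeps the scaled point inside the open ball. *)
Lemma gauge_lipschitz : exists2 C, 0 < C &
  forall x y, `|gauge K x - gauge K y| <= C * `|x - y|.
Proof.
have [r r0 rK] := interior0_ball oK; exists (2 / r); first by rewrite divr_gt0.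
have H z : gauge K z <= 2 / r * `|z|.
  have [->|z0] := eqVneq z 0.
    by rewrite (sublinear0 gauge_sublinear) normr0 mulr0.
  have z0' : 0 < `|z| by rewrite normr_gt0.
  apply: gauge_le; first by rewrite mulr_gt0// divr_gt0.
  apply: rK; rewrite normrZ gtr0_norm ?invr_gt0 ?mulr_gt0 ?invr_gt0//.
  by rewrite invfM -mulrA mulVf ?gt_eqF// mulr1 invf_div; lra.
move=> x y; have [gD _] := gauge_sublinear.
have := gD (x - y) y; have := gD (y - x) x; rewrite !subrK => h1 h2.
rewrite ler_norml; have := H (x - y); have := H (y - x).
by rewrite distrC; lra.
Qed.

(** If the gauge is at most 1, the points [(1 + d)^-1 *: x] lie in [K] for all [d > 0] and tend to
    [x]; [K] is closed. *)
Lemma gauge_le1P x : gauge K x <= 1 <-> K x.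
Proof.
split=> [x1|Kx]; last by apply: gauge_le; rewrite // invr1 scale1r.
have clK : closed K by case: bK => cK _ _; apply: compact_closed cK; exact: norm_hausdorff.
apply: clK => B /nbhs_ballP[e /= e0 eB].
have x10 : 0 < 1 + `|x| by rewrite ltr_wpDr.
pose d := e / (1 + `|x|).
have d0 : 0 < d by rewrite divr_gt0.
exists ((1 + d)^-1 *: x); split; first by apply: gauge_lt; rewrite (le_lt_trans x1)// ltrDl.
apply: eB; rewrite -ball_normE /=.
have -> : x - (1 + d)^-1 *: x = (d / (1 + d)) *: x.
  rewrite -{1}(scale1r x) -scalerBl; congr (_ *: _).
  by clearbody d; field; rewrite gt_eqF// addr_gt0.
have d1 : 0 < 1 + d by rewrite addr_gt0.
rewrite normrZ gtr0_norm ?(divr_gt0 d0 d1)//.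
apply: (@le_lt_trans _ _ (d * `|x|)).
  by rewrite ler_wpM2r// ler_pdivrMr// ler_peMr ?(ltW d0)// lerDl ltW.
by rewrite /d mulrAC ltr_pdivrMr// ltr_pM2l//; lra.
Qed.

Lemma gauge_gt0 x : x != 0 -> 0 < gauge K x.
Proof.
move=> x0; have [M M0 KM] := convex_body_bounded bK.
have xp : 0 < `|x| by rewrite normr_gt0.
apply: (@lt_le_trans _ _ (`|x| / M)); first by rewrite divr_gt0.
apply: lb_le_inf; [exact: gset_n0|move=> t [t0 /KM]].
rewrite normrZ gtr0_norm ?invr_gt0// => tM.
by rewrite ler_pdivrMr// mulrC -ler_pdivrMr// mulrC.
Qed.

(** An interior point can be stretched by some factor [1 + d] without leaving [K]. Hence points of
    gauge 1 are boundary points. *)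
Lemma gauge_interior_lt1 x : K° x -> gauge K x < 1.
Proof.
have [->|x0] := eqVneq x 0.
  by rewrite (sublinear0 gauge_sublinear) ltr01.
have xp : 0 < `|x| by rewrite normr_gt0.
move=> /nbhs_ballP[e /= e0 eK].
pose d := e / 2 / `|x|.
have d0 : 0 < d by rewrite !divr_gt0.
have /gauge_le1P : K ((1 + d) *: x).
  apply: eK; rewrite -ball_normE /= -{1}(scale1r x) -scalerBl opprD addNKr.
  by rewrite normrZ normrN gtr0_norm// /d divfK ?gt_eqF//; lra.
rewrite gaugeZ ?addr_ge0 ?(ltW d0)// => h.
have d1 : 0 < 1 + d by rewrite addr_gt0.
apply: (@le_lt_trans _ _ (1 + d)^-1); last by rewrite invf_lt1// ltrDl.
by rewrite -[leRHS]mulr1 ler_pdivlMl.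
Qed.

Lemma radial_fun_gauge u : u != 0 -> radial_fun K u = (gauge K u)^-1.
Proof.
move=> u0; have g0 := gauge_gt0 u0.
rewrite /radial_fun; set A := [set _ | _].
have AP l : A l <-> 0 < l /\ l <= (gauge K u)^-1.
  split=> -[l0] h; split=> //.
    by move/gauge_le1P: h; rewrite gaugeZ ?(ltW l0)// -ler_pdivlMr// mul1r.
  by apply/gauge_le1P; rewrite gaugeZ ?(ltW l0)// -ler_pdivlMr// mul1r.
have Ag : A (gauge K u)^-1 by apply/AP; rewrite invr_gt0.
apply/le_anti/andP; split.
  by apply: ge_sup; [exists (gauge K u)^-1|move=> l /AP[]].
by apply: ub_le_sup => //; exists (gauge K u)^-1 => l /AP[].
Qed.

Let support_has_ub v : has_ubound [set dotv v x | x in K].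
Proof.
have [M M0 KM] := convex_body_bounded bK.
exists (n%:R * (`|v| * M)) => _ [x Kx <-].
apply: le_trans (ler_norm _) _; apply: le_trans (dotv_le_norm _ _) _.
by rewrite !ler_wpM2l// KM.
Qed.

Lemma support_fun_ge v x : K x -> dotv v x <= support_fun K v.
Proof. by move=> Kx; apply: ub_le_sup => //; exists x. Qed.

Lemma support_fun_lipschitz : exists2 C, 0 < C &
  forall v w, `|support_fun K v - support_fun K w| <= C * `|v - w|.
Proof.
have [M M0 KM] := convex_body_bounded bK.
(* The summand 1 keeps the constant positive when [n = 0]. *)
exists (n%:R * M + 1); first by rewrite ltr_wpDl// mulr_ge0// ltW.
have H v w : support_fun K v <= support_fun K w + (n%:R * M + 1) * `|v - w|.
  apply: ge_sup; first by exists (dotv v 0), 0.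
  move=> _ [x Kx <-]; rewrite -(subrK w v) dotvDl addrC lerD ?support_fun_ge//.
  apply: le_trans (ler_norm _) _; apply: le_trans (dotv_le_norm _ _) _.
  rewrite subrK mulrDl mul1r; apply: ler_wpDr => //.
  by rewrite -mulrA ler_wpM2l// mulrC ler_wpM2r// KM.
move=> v w; have := H v w; have := H w v.
by rewrite ler_norml (distrC w); lra.
Qed.

Lemma support_fun_gt0 v : sphere R n v -> 0 < support_fun K v.
Proof.
move=> v1; have [r r0 rK] := interior0_ball oK.
have : dotv v ((r / 2) *: v) <= support_fun K v.
  apply: support_fun_ge; apply: rK; rewrite normrZ gtr0_norm ?divr_gt0//.
  apply: (@le_lt_trans _ _ (r / 2)); last by lra.
  by rewrite ler_piMr ?(norm_sphere_le1 v1)// divr_ge0// ltW.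
by rewrite dotvZr (sphere_dotv v1) mulr1; apply: lt_le_trans; rewrite divr_gt0.
Qed.

(** Hahn-Banach for the gauge at [u] gives [w] with [dotv x w <= 1] on [K] and equality at the
    boundary point in direction [u]. Normalizing [w] gives the normal, with support value
    [(enorm w)^-1]. *)
Lemma outer_unit_normal_exists u : sphere R n u ->
  exists v, outer_unit_normal K (radial_fun K u *: u) v.
Proof.
move=> u1; have u0 := sphere_neq0 u1; have g0 := gauge_gt0 u0.
rewrite radial_fun_gauge//.
have [w [wg wu]] := hahn_banach_sublinear u gauge_sublinear.
have w0 : w != 0.
  apply: contraTneq g0 => w0; rewrite -wu w0 -(scale0r (0 : 'rV[R]_n)) dotvZr mul0r.
  by rewrite ltxx.
have ew := enorm_gt0 w0.
have gx : gauge K ((gauge K u)^-1 *: u) = 1.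
  by rewrite gaugeZ ?invr_ge0 ?(ltW g0)// mulVf ?gt_eqF.
have Kx : K ((gauge K u)^-1 *: u) by apply/gauge_le1P; rewrite gx.
exists ((enorm w)^-1 *: w); split.
- exact: sphere_normalize.
- split; first exact: subset_closure.
  by move=> /gauge_interior_lt1; rewrite gx ltxx.
- have E : dotv ((gauge K u)^-1 *: u) ((enorm w)^-1 *: w) = (enorm w)^-1.
    by rewrite dotvZl dotvZr wu mulrCA mulVf ?gt_eqF// mulr1.
  rewrite E; apply/le_anti/andP; split.
    by rewrite -{1}E dotvC support_fun_ge.
  apply: ge_sup; first by exists (dotv ((enorm w)^-1 *: w) 0), 0.
  move=> _ [x /gauge_le1P x1 <-]; rewrite dotvZl -[leRHS]mulr1.
  by rewrite ler_wpM2l ?invr_ge0 ?enorm_ge0// dotvC (le_trans (wg x)).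
Qed.

End Body.

Lemma radial_mem K u : convex_body K -> K° 0 -> sphere R n u ->
  K (radial_fun K u *: u).
Proof.
move=> bK oK u1; have u0 := sphere_neq0 u1; have g0 := gauge_gt0 bK oK u0.
rewrite radial_fun_gauge//; apply/gauge_le1P => //.
by rewrite gaugeZ// ?invr_ge0 ?(ltW g0)// mulVf ?gt_eqF.
Qed.

(** * Comparing radial and support functions of two bodies *)

Section Comparison.
Variables K L : set 'rV[R]_n.
Hypotheses (bK : convex_body K) (oK : K° 0) (bL : convex_body L) (oL : L° 0).

Lemma lt_radial_fun u : sphere R n u ->
  (radial_fun L u < radial_fun K u) = (gauge K u < gauge L u).
Proof.
move=> /sphere_neq0 u0; rewrite !radial_fun_gauge// ltf_pV2// posrE.
  exact: gauge_gt0.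
exact: gauge_gt0.
Qed.

(** With [r_K], [r_L] the radii in direction [u]: [r_L (u.v) <= h_L v < h_K v = r_K (u.v)]. Dividing
    is possible since [h_K v > 0] forces [u.v > 0]. *)
Lemma lt_gauge_of_normal u v : sphere R n u ->
  outer_unit_normal K (radial_fun K u *: u) v ->
  support_fun L v < support_fun K v -> gauge K u < gauge L u.
Proof.
move=> u1 [v1 _]; rewrite dotvZl => hK LK.
rewrite -lt_radial_fun//.
have rK0 : 0 < radial_fun K u.
  by rewrite radial_fun_gauge// ?sphere_neq0// invr_gt0 gauge_gt0// sphere_neq0.
have uv0 : 0 < dotv u v.
  by rewrite -(pmulr_rgt0 _ rK0) hK support_fun_gt0.
rewrite -(ltr_pM2r uv0) hK; apply: le_lt_trans LK.
by rewrite -dotvZl dotvC support_fun_ge//; exact: radial_mem.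
Qed.

(** Here [v] is normal to [L], so [h_L v = r_L (u.v) < r_K (u.v) <= h_K v]. *)
Lemma lt_support_of_normal u v : sphere R n u ->
  outer_unit_normal L (radial_fun L u *: u) v ->
  gauge K u < gauge L u -> support_fun L v < support_fun K v.
Proof.
move=> u1 [v1 _]; rewrite dotvZl => hL; rewrite -lt_radial_fun// => LK.
have rL0 : 0 < radial_fun L u.
  by rewrite radial_fun_gauge// ?sphere_neq0// invr_gt0 gauge_gt0// sphere_neq0.
have uv0 : 0 < dotv u v.
  by rewrite -(pmulr_rgt0 _ rL0) hL support_fun_gt0.
rewrite -hL; apply: (@lt_le_trans _ _ (radial_fun K u * dotv u v)).
  by rewrite ltr_pM2r.
by rewrite -dotvZl dotvC support_fun_ge//; exact: radial_mem.
Qed.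

End Comparison.

End Gauge.

(** * Hausdorff measure *)

Section HausdorffMetric.
Context (R : realType) (n : nat).
Local Open Scope ereal_scope.
Implicit Types A B U V X : set 'rV[R]_n.

Lemma le_ediam U V : U `<=` V -> ediam U <= ediam V.
Proof.
move=> UV; apply: ereal_sup_le => _ [[x y] [Ux Uy] <-]; exists (x, y) => //.
by split; exact: UV.
Qed.

Lemma ediam_ub U x y : U x -> U y -> (enorm (x - y))%:E <= ediam U.
Proof. by move=> Ux Uy; apply: ereal_sup_ubound; exists (x, y). Qed.

Lemma lee_expe (x y : \bar R) m : 0 <= x -> x <= y -> x ^+ m <= y ^+ m.
Proof.
by move=> x0 xy; elim: m => // m IH; rewrite !expeS lee_pmul// expe_ge0.
Qed.

Lemma le_diam_weight m U V : U `<=` V -> diam_weight m U <= diam_weight m V.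
Proof.
move=> UV; have [->|/set0P U0] := eqVneq U set0.
  by rewrite diam_weight0 diam_weight_ge0.
have V0 : V !=set0 by apply: subset_nonempty U0.
rewrite /diam_weight !asboolF; [|exact/eqP/set0P..].
have U0' := ediam_ge0 U0.
rewrite lee_pmul ?lee_fin ?unit_ball_volume_ge0 ?expe_ge0 ?mule_ge0//.
rewrite lee_expe ?mule_ge0 ?lee_pmul//; exact: le_ediam.
Qed.

Lemma hausdorff_content_anti m (d1 d2 : R) A : (d1 <= d2)%R ->
  hausdorff_content m d2 A <= hausdorff_content m d1 A.
Proof.
move=> d12; apply: ereal_inf_le_tmp => _ [F [AF Fd] <-]; exists F => //.
by split=> // i; apply: le_trans (Fd i) _; rewrite lee_fin.
Qed.

(** A covering set of diameter at most [d < e] cannot meet both [A] and [B], so a cover of the union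
    splits into covers of the two sets without extra cost. *)
Lemma hausdorff_contentU_separated m (d e : R) A B : (d < e)%R ->
  (forall x y, A x -> B y -> (e <= enorm (x - y))%R) ->
  hausdorff_content m d A + hausdorff_content m d B <=
  hausdorff_content m d (A `|` B).
Proof.
move=> de sep; apply: le_ereal_inf_tmp => _ [F [ABF Fd] <-].
apply: (@le_trans _ _ (\sum_(i <oo) diam_weight m (F i `&` A) +
                       \sum_(i <oo) diam_weight m (F i `&` B))).
  apply: leeD; apply: ereal_inf_lbound.
    exists (fun i => F i `&` A) => //; split=> [x Ax|i].
      by have [i _ Fi] := ABF x (or_introl Ax); exists i.
    by apply: le_trans (Fd i); apply: le_ediam => x [].
  exists (fun i => F i `&` B) => //; split=> [x Bx|i].
    by have [i _ Fi] := ABF x (or_intror Bx); exists i.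
  by apply: le_trans (Fd i); apply: le_ediam => x [].
rewrite -nneseriesD; [|by move=> *; exact: diam_weight_ge0..].
apply: lee_nneseries => [i _ _|i _].
  by rewrite adde_ge0// diam_weight_ge0.
have [->|/set0P[x [Fx Ax]]] := eqVneq (F i `&` A) set0.
  by rewrite diam_weight0 add0e; apply: le_diam_weight => x [].
have [->|/set0P[y [Fy By]]] := eqVneq (F i `&` B) set0.
  by rewrite diam_weight0 adde0; apply: le_diam_weight => z [].
have := le_trans (ediam_ub Fx Fy) (Fd i); rewrite lee_fin => xyd.
by have := le_lt_trans (le_trans (sep _ _ Ax By) xyd) de; rewrite ltxx.
Qed.

Lemma hausdorff_content_le m (d : R) A : (0 < d)%R ->
  hausdorff_content m d A <= hausdorff m A.
Proof. by move=> d0; apply: ereal_sup_ubound; exists d. Qed.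

Lemma hausdorffU_separated m (e : R) A B : (0 < e)%R ->
  (forall x y, A x -> B y -> (e <= enorm (x - y))%R) ->
  hausdorff m A + hausdorff m B <= hausdorff m (A `|` B).
Proof.
move=> e0 sep; set c := hausdorff m (A `|` B).
have c0 : 0 <= c by exact: hausdorff_ge0.
have [->|cy] := eqVneq c +oo; first exact: leey.
have cfin : c \is a fin_num by rewrite ge0_fin_numE// lt_neqAle cy leey.
(* Independent scales allow the two suprema to be taken one after the other. Both contents can only
   grow on passing to the common scale [d < e]. *)
have key d1 d2 : (0 < d1)%R -> (0 < d2)%R ->
    hausdorff_content m d1 A + hausdorff_content m d2 B <= c.
  move=> d10 d20.
  pose d := Num.min (Num.min d1 d2) (e / 2)%R.
  have d0 : (0 < d)%R by rewrite !lt_min d10 d20 divr_gt0.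
  have dd1 : (d <= d1)%R by rewrite !ge_min lexx.
  have dd2 : (d <= d2)%R by rewrite !ge_min lexx orbT.
  have de : (d < e)%R.
    by apply: (@le_lt_trans _ _ (e / 2)%R); [rewrite ge_min lexx orbT|lra].
  apply: (@le_trans _ _ (hausdorff_content m d A + hausdorff_content m d B)).
    by apply: leeD; exact: hausdorff_content_anti.
  apply: le_trans (hausdorff_contentU_separated m de sep) _.
  exact: hausdorff_content_le.
have cont_ge0 d D : (0 < d)%R -> 0 <= hausdorff_content m d D.
  move=> d0; apply: le_ereal_inf_tmp => _ [F _ <-].
  by apply: nneseries_ge0 => i _ _; exact: diam_weight_ge0.
have fin d D : (0 < d)%R -> hausdorff_content m d D <= c ->
    hausdorff_content m d D \is a fin_num.
  move=> d0 Dc; rewrite ge0_fin_numE ?cont_ge0//.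
  by apply: le_lt_trans Dc _; rewrite -ge0_fin_numE.
have HA d2 : (0 < d2)%R -> hausdorff m A + hausdorff_content m d2 B <= c.
  move=> d20.
  have fB : hausdorff_content m d2 B \is a fin_num.
    apply: fin => //; apply: le_trans (key 1%R d2 ltr01 d20).
    by rewrite leeDr// cont_ge0.
  rewrite -leeBrDr//; apply: ge_ereal_sup => _ [d1 d10 <-].
  by rewrite leeBrDr// key.
have fA : hausdorff m A \is a fin_num.
  rewrite ge0_fin_numE ?hausdorff_ge0//; apply: (@le_lt_trans _ _ c).
    by apply: le_trans (HA 1%R ltr01); rewrite leeDl// cont_ge0.
  by rewrite -ge0_fin_numE.
rewrite addeC -leeBrDr//; apply: ge_ereal_sup => _ [d2 d20 <-].
by rewrite leeBrDr// addeC HA.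
Qed.

(* The shells between consecutive levels [c + 1/(k+1)] are pairwise separated
   except for neighbours, hence their measures are summable; so the points just
   above the level [c] carry little measure. *)
Lemma lipschitz_caratheodory m (C : R) (f : 'rV[R]_n -> R) (c : R) :
  (0 < C)%R ->
  (forall x y, (`|f x - f y| <= C * enorm (x - y))%R) ->
  caratheodory_measurable (@hausdorff R n m) [set x | (f x <= c)%R].
Proof.
move=> C0 fC; apply: le_caratheodory_measurable => X /=.
pose mu : {outer_measure set 'rV[R]_n -> \bar R} := @hausdorff R n m.
rewrite -/(mu _) -/(mu _) -/(mu _).
have [->|Xy] := eqVneq (mu X) +oo; first exact: leey.
have Xfin : mu X \is a fin_num.
  by rewrite ge0_fin_numE ?outer_measure_ge0// lt_neqAle Xy leey.
have sep (a b : R) A B : (a < b)%R -> (forall x, A x -> (f x <= a)%R) ->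
    (forall x, B x -> (b <= f x)%R) -> mu A + mu B <= mu (A `|` B).
  move=> ab Aa Bb; apply: (@hausdorffU_separated m ((b - a) / C)%R).
    by rewrite divr_gt0// subr_gt0.
  move=> x y Ax By; rewrite ler_pdivrMr// mulrC.
  apply: le_trans (fC x y); rewrite distrC; apply: le_trans (ler_norm _).
  by apply: lerB; [exact: Bb|exact: Aa].
pose a (k : nat) : R := (k.+1%:R^-1)%R.
have alt j k : (j < k)%N -> (a k < a j)%R.
  by move=> jk; rewrite /a ltf_pV2 ?posrE// ltr_nat.
pose B k := X `&` [set x | (c + a k <= f x)%R].
pose S k := X `&` [set x | (c + a k.+1 <= f x < c + a k)%R].
have BX k : mu (B k) <= mu X by apply: le_outer_measure => x [].
(* Induction: [S N.+1] is separated from [B N] by the shell between them, and their union lies in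
   [B N.+2], so the bound moves up by one index. *)
have sumS N : \sum_(j < N) mu (S j.+1) <= mu (B N) + mu (B N.+1).
  elim: N => [|N IH]; first by rewrite big_ord0 adde_ge0// outer_measure_ge0.
  rewrite big_ord_recr/=; apply: le_trans (leeD2r _ IH) _.
  rewrite addeAC addeC; apply: leeD => //.
  rewrite addeC.
  apply: le_trans (@sep (c + a N.+1)%R (c + a N)%R _ _ _ _ _) _.
  - by rewrite ltrD2l alt.
  - by move=> x [_ /= /andP[_ /ltW]].
  - by move=> x [].
  apply: le_outer_measure => x [[Xx /= /andP[h _]]|[Xx /= h]]; split=> //=.
  by apply: le_trans h; rewrite lerD2l ltW// alt.
have ser : \sum_(j <oo) mu (S j.+1) < +oo.
  apply: (@le_lt_trans _ _ (mu X + mu X)); last first.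
    by rewrite -ge0_fin_numE ?adde_ge0 ?outer_measure_ge0// fin_numD Xfin.
  apply: lime_le.
    by apply: is_cvg_nneseries => j _ _; exact: outer_measure_ge0.
  apply: nearW => N; rewrite big_mkord; apply: le_trans (sumS N) _.
  by apply: leeD; exact: BX.
have tail := nneseries_tail_cvg ser (fun k _ => outer_measure_ge0 mu (S k.+1)).
apply/lee_addgt0Pr => e e0.
have [k tk] : exists k : nat, \sum_(k <= j <oo) mu (S j.+1) < e%:E.
  have : \forall N \near \oo, \sum_(N <= j <oo) mu (S j.+1) < e%:E.
    apply: (tail (fun x => x < e%:E)); apply: open_nbhs_nbhs; split.
      exact: open_ereal_lt_ereal.
    by rewrite /= lte_fin.
  by move=> [k _ H]; exists k; apply: H => /=.
have XB : mu (X `&` ~` [set x | (f x <= c)%R]) <=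
    mu (B k.+1) + \sum_(k <= j <oo) mu (S j.+1).
  rewrite -(@nneseries_addn _ (fun j => mu (S j.+1)))//.
  apply: le_trans (leeD2l _ (outer_measure_sigma_subadditive mu _)).
  apply: le_trans (outer_measureU2 mu _ _).
  apply: le_outer_measure => x [Xx /= /negP]; rewrite -ltNge => cfx.
  have [kfx|fxk] := leP (c + a k.+1)%R (f x); [by left|right].
  (* The least such [j] locates [x] in the shell [S j.-1]. *)
  have ex : exists j, (c + a j <= f x)%R.
    exists (Num.truncn (f x - c)^-1)%R.
    rewrite -lerBrDl /a -[leRHS]invrK lef_pV2 ?posrE ?invr_gt0 ?subr_gt0//.
    by rewrite ltW// truncnS_gt.
  case: (ex_minnP ex) => j jfx jmin.
  have kj : (k.+1 < j)%N.
    rewrite ltnNge; apply/negP; rewrite leq_eqVlt => /predU1P[jk|/alt jk].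
      by move: jfx; rewrite jk leNgt fxk.
    have := le_lt_trans jfx fxk.
    by rewrite ltrD2l ltNge ltW.
  exists (j - k.+2)%N => //; split=> //=.
  have -> : (j - k.+2 + k).+1 = j.-1 by lia.
  rewrite prednK ?(leq_ltn_trans _ kj)// jfx /= ltNge.
  by apply/negP => /jmin; rewrite leqNgt prednK ?leqnn// (leq_ltn_trans _ kj).
apply: le_trans (leeD2l _ XB) _.
rewrite addeA; apply: leeD; last exact: ltW.
apply: le_trans (@sep c (c + a k.+1)%R _ _ _ _ _) _.
- by rewrite ltrDl /a invr_gt0.
- by move=> x [].
- by move=> x [].
by apply: le_outer_measure => x [[]|[]].
Qed.

End HausdorffMetric.

(** * Monotonicity of the integral of nonnegative functions *)

Section NonmeasurableIntegral.
Local Open Scope ereal_scope.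
Import HBNNSimple.

(* The library's [ge0_le_integral] asks for measurability of both sides, which is
   not available for the reverse radial Gauss images. *)
Lemma ge0_subset_le_integral d (T : measurableType d) (R : realType)
    (mu : {measure set T -> \bar R}) (A B : set T) (f g : T -> \bar R) :
  A `<=` B -> (forall x, A x -> 0 <= f x) -> (forall x, B x -> 0 <= g x) ->
  (forall x, A x -> f x <= g x) ->
  \int[mu]_(x in A) f x <= \int[mu]_(x in B) g x.
Proof.
move=> AB f0 g0 fg; rewrite (integral_mkcond A) (integral_mkcond B).
have fA0 x : 0 <= (f \_ A) x by rewrite patchE; case: ifPn => // /set_mem /f0.
have gB0 x : 0 <= (g \_ B) x by rewrite patchE; case: ifPn => // /set_mem /g0.
have fgAB x : (f \_ A) x <= (g \_ B) x.
  rewrite [leLHS]patchE; case: ifPn => [/set_mem Ax|_]; last exact: gB0.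
  by rewrite patchE mem_set; [exact: fg|exact: AB].
rewrite !ge0_integralTE//; apply: ereal_sup_le => _ [h hf <-]; exists h => // x.
exact: le_trans (hf x) (fgAB x).
Qed.

End NonmeasurableIntegral.

(** * Lower bound for Hausdorff measure through Lipschitz charts *)

Section LowerBound.
Context (R : realType).
Local Open Scope ereal_scope.

(* Induction on the dimension, integrating the covering inequality over the last
   coordinate; this replaces Lebesgue measure on R^m. *)
Lemma unit_cube_cover_le m (c : nat -> R) (lo hi : nat -> nat -> R) :
  (forall k, 0 <= c k)%R -> (forall k j, lo k j <= hi k j)%R ->
  (forall y : nat -> R, (forall j, (0 <= y j <= 1)%R) ->
     1 <= \sum_(k <oo)
       (c k * \prod_(j < m) (\1_(`[lo k j, hi k j]%classic) (y j) : R))%:E) ->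
  1 <= \sum_(k <oo) (c k * \prod_(j < m) (hi k j - lo k j))%:E.
Proof.
elim: m c => [|m IH] c c0 lohi H.
  apply: le_trans (H (fun=> 0%R) _) _ => [j|]; first by rewrite lexx ler01.
  rewrite le_eqVlt; apply/orP; left; apply/eqP.
  by apply: eq_eseriesr => k _; rewrite !big_ord0.
under eq_eseriesr do rewrite big_ord_recr/= mulrA mulrAC.
(* The weights absorb the last side length; this is why the statement carries general weights
   [c]. *)
apply: (IH (fun k => c k * (hi k m - lo k m))%R) => // [k|y y01].
  by rewrite mulr_ge0// subr_ge0.
pose I k := (`[lo k m, hi k m]%classic : set R).
pose d k : R := (c k * \prod_(j < m) (\1_(`[lo k j, hi k j]%classic) (y j) : R))%R.
have d0 k : (0 <= d k)%R by rewrite mulr_ge0// prodr_ge0.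
have key (t : R) : `[0%R, 1%R]%classic t ->
    1 <= \sum_(k <oo) (d k)%:E * (\1_(I k) t)%:E.
  rewrite /= in_itv /= => t01.
  have := H (fun j => if j == m then t else y j).
  have E k : ((c k * \prod_(j < m.+1) (\1_(`[lo k j, hi k j]%classic)
      (if (j : nat) == m then t else y j) : R))%R)%:E = (d k)%:E * (\1_(I k) t)%:E.
    rewrite big_ord_recr/= eqxx mulrA EFinM; congr (_%:E * _).
    congr (_ * _)%R; apply: eq_bigr => j _.
    by rewrite ltn_eqF.
  under eq_eseriesr do rewrite E.
  by apply => j; case: ifP.
have mI k : measurable (I k) by exact: measurable_itv.
have one : \int[lebesgue_measure]_(t in `[0%R, 1%R]%classic) (cst 1 t) = 1 :> \bar R.
  by rewrite integral_cst//= lebesgue_measure_itv/= lte_fin ltr01 sube0 mule1.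
rewrite -[leLHS]one.
apply: (@le_trans _ _ (\int[lebesgue_measure]_(t in `[0%R, 1%R]%classic)
    \sum_(k <oo) (d k)%:E * (\1_(I k) t)%:E)).
  apply: ge0_subset_le_integral => // t _.
  by apply: nneseries_ge0 => k _ _; rewrite mule_ge0// lee_fin.
rewrite integral_nneseries//; last 2 first.
- move=> k; apply: measurable_funeM; apply/measurable_EFinP.
  by apply: measurable_indic; exact: mI.
- by move=> k t _; rewrite mule_ge0// lee_fin.
apply: lee_nneseries => [k _ _|k _].
  by apply: integral_ge0 => t _; rewrite mule_ge0// lee_fin.
rewrite ge0_integralZl_EFin//; last first.
  by apply/measurable_EFinP; apply: measurable_indic; exact: mI.
rewrite integral_indic//; last exact: mI.
have -> : (c k * (hi k m - lo k m) * \prod_(j < m) (\1_(`[lo k j, hi k j]%classic) (y j) : R))%:E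
    = (d k)%:E * (hi k m - lo k m)%:E by rewrite -EFinM /d mulrAC.
apply: lee_wpmul2l; first by rewrite lee_fin.
apply: (@le_trans _ _ (lebesgue_measure (I k))).
  apply: le_measure; rewrite ?inE; [|exact: mI|exact: subIsetl].
  by apply: measurableI; [exact: mI|exact: measurable_itv].
rewrite lebesgue_measure_itv/= lte_fin; case: ifP => //.
by rewrite lee_fin subr_ge0.
Qed.

Lemma unit_ball_volume_gt0 m : (0 < unit_ball_volume R m)%R.
Proof.
elim/ltn_ind: m => -[|[|m]] IH //=.
by rewrite mulr_gt0 ?IH // divr_gt0 // mulr_gt0 // pi_gt0.
Qed.

Lemma term_le_nneseries (f : nat -> \bar R) i :
  (forall k, 0 <= f k) -> f i <= \sum_(k <oo) f k.
Proof.
move=> f0; apply: le_trans (nneseries_lim_ge i.+1 _) => //.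
by rewrite big_nat_recr//= leeDr// sume_ge0.
Qed.

(** The chart sends each covering set, cut down to [A], into a cube of side [2 C] times its
    diameter. These cubes cover the unit cube, so their volumes sum to at least 1. *)
Lemma hausdorff_gt0_chart n m (A : set 'rV[R]_n) (phi : 'rV[R]_n -> 'I_m -> R)
    (C : R) : (0 < C)%R ->
  (forall x y j, A x -> A y -> (`|phi x j - phi y j| <= C * enorm (x - y))%R) ->
  (forall y : 'I_m -> R, (forall j, (0 <= y j <= 1)%R) ->
     exists2 x, A x & forall j, phi x j = y j) ->
  0 < hausdorff m A.
Proof.
move=> C0 philip phisurj.
(* Chosen so that [kappa] times the cube volume [(2 C diam)^m] is the weight of the covering set,
   whose diameter is halved in [diam_weight]. *)
pose kappa : R := (unit_ball_volume R m / (4 * C) ^+ m)%R.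
have kappa0 : (0 < kappa)%R.
  by rewrite divr_gt0 ?unit_ball_volume_gt0// exprn_gt0// mulr_gt0.
apply: (@lt_le_trans _ _ kappa%:E); first by rewrite lte_fin.
apply: le_trans (hausdorff_content_le m A (ltr01 : (0 < 1 :> R)%R)).
apply: le_ereal_inf_tmp => _ [F [AF Fd] <-].
pose ne i := F i `&` A !=set0.
pose p i := xget 0%R (F i `&` A).
have pP i : ne i -> (F i `&` A) (p i) by move=> [x Fx]; exact: (xgetI _ Fx).
(* Covering sets that miss [A] get weight 0, so the default value of [p i] there is harmless. *)
pose c i : R := if `[< ne i >] then 1%R else 0%R.
pose s i : R := if `[< ne i >] then (C * fine (ediam (F i)))%R else 0%R.
pose ph i (j : nat) : R := oapp (phi (p i)) 0%R (insub j).
have fd i : ne i -> ediam (F i) = (fine (ediam (F i)))%:E /\ (0 <= fine (ediam (F i)))%R.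
  move=> [x [Fx _]]; have e0 := ediam_ge0 (ex_intro _ x Fx).
  rewrite fineK; first by split=> //; exact: fine_ge0.
  by rewrite ge0_fin_numE// (le_lt_trans (Fd i))// ltry.
have s0 i : (0 <= s i)%R.
  rewrite /s; case: asboolP => // /fd[_ h]; exact: mulr_ge0 (ltW C0) h.
have c0 i : (0 <= c i)%R by rewrite /c; case: ifP.
have := @unit_cube_cover_le m c (fun i j => ph i j - s i)%R (fun i j => ph i j + s i)%R c0.
have lohi : forall k j : nat, (ph k j - s k <= ph k j + s k)%R.
  by move=> k j; rewrite lerD2l; apply: le_trans (s0 k); rewrite oppr_le0.
move=> /(_ lohi) cover.
have one : 1 <= \sum_(k <oo) (c k * (2 * s k) ^+ m)%:E.
  have -> : \sum_(k <oo) (c k * (2 * s k) ^+ m)%:E =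
      \sum_(k <oo) (c k * \prod_(j < m) (ph k j + s k - (ph k j - s k)))%:E.
    apply: eq_eseriesr => k _; congr (_ * _)%:E.
    rewrite -[in LHS](card_ord m) -prodr_const; apply: eq_bigr => j _.
    by ring.
  apply: cover => y y01.
  have [x Ax xy] := phisurj (fun j => y j) (fun j => y01 j).
  have [i _ Fx] := AF x Ax.
  have nei : ne i by exists x.
  have [Fp Ap] := pP i nei.
  apply: le_trans (term_le_nneseries i _); last first.
    by move=> k; rewrite lee_fin mulr_ge0// prodr_ge0.
  rewrite lee_fin /c asboolT// mul1r big1// => j _.
  rewrite indicE mem_set//= in_itv /= /ph valK /= -xy /s asboolT//.
  have := philip x (p i) j Ax Ap.
  have := ediam_ub Fx Fp; rewrite (fd i nei).1 lee_fin => h1 h2.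
  have := le_trans h2 (ler_wpM2l (ltW C0) h1).
  by rewrite ler_norml; lra.
apply: (@le_trans _ _ (\sum_(k <oo) kappa%:E * (c k * (2 * s k) ^+ m)%:E)).
  rewrite nneseriesZl ?lee_pemulr ?lee_fin ?(ltW kappa0)//.
  by move=> k _; rewrite lee_fin mulr_ge0// exprn_ge0// mulr_ge0.
apply: lee_nneseries => [k _ _|k _].
  by rewrite -EFinM lee_fin mulr_ge0 ?(ltW kappa0)// mulr_ge0// exprn_ge0// mulr_ge0.
rewrite /c /s; case: asboolP => [nek|_]; last first.
  by rewrite mul0r mule0 diam_weight_ge0.
have [fE _] := fd k nek; have [x [Fx _]] := nek.
rewrite /diam_weight asboolF; last by move=> F0; move: Fx; rewrite F0.
rewrite fE -!EFinM -EFin_expe -EFinM lee_fin mul1r /kappa.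
rewrite -mulrA ler_wpM2l ?unit_ball_volume_ge0// -exprVn -exprMn.
by rewrite le_eqVlt; apply/orP; left; apply/eqP; congr (_ ^+ _)%R; field; rewrite gt_eqF.
Qed.

End LowerBound.

(** * Hausdorff measure of the sphere *)

Section SphereMeasure.
Context (R : realType) (n : nat).

Local Open Scope ereal_scope.

Lemma hausdorff_content_finite_cover m (d : R) (A : set 'rV[R]_n) (T : finType)
    (G : T -> set 'rV[R]_n) : (0 <= d)%R ->
  A `<=` \bigcup_t G t -> (forall t, ediam (G t) <= d%:E) ->
  hausdorff_content m d A <=
    (#|T|%:R * (unit_ball_volume R m * (2^-1 * d) ^+ m))%:E.
Proof.
move=> d0 AG Gd.
pose F i := oapp (fun k : 'I_#|T| => G (enum_val k)) set0 (insub i).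
have dG t : diam_weight m (G t) <= (unit_ball_volume R m * (2^-1 * d) ^+ m)%:E.
  have [->|/set0P G0] := eqVneq (G t) set0.
    rewrite diam_weight0 lee_fin mulr_ge0 ?unit_ball_volume_ge0// exprn_ge0//.
    by rewrite mulr_ge0// invr_ge0.
  rewrite /diam_weight asboolF; last exact/eqP/set0P.
  rewrite EFinM EFin_expe EFinM; apply: lee_wpmul2l.
    by rewrite lee_fin unit_ball_volume_ge0.
  apply: lee_expe; first by rewrite mule_ge0 ?ediam_ge0// lee_fin invr_ge0.
  by apply: lee_wpmul2l; rewrite ?lee_fin ?invr_ge0.
apply: (@le_trans _ _ (\sum_(i <oo) diam_weight m (F i))).
  apply: ereal_inf_lbound; exists F => //; split.
    move=> x /AG[t _ Gx]; exists (enum_rank t) => //.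
    by rewrite /F valK /= enum_rankK.
  move=> i; rewrite /F; case: insub => [k|] /=; first exact: Gd.
  by rewrite ediam0 leNye.
rewrite (nneseries_split _ #|T|); last by move=> *; exact: diam_weight_ge0.
rewrite [X in _ + X]eseries0 ?adde0; last first.
  by move=> i; rewrite add0n => Ti _; rewrite /F insubF ?diam_weight0// ltnNge Ti.
rewrite add0n big_mkord.
set k0 := (_ * _ ^+ m)%R.
apply: (@le_trans _ _ (\sum_(i < #|T|) k0%:E)).
  by apply: lee_sum => i _; rewrite /F valK; exact: dG.
by rewrite sumEFin sumr_const card_ord mulr_natl.
Qed.

(** The squared distances differ by [(r - s)^2 + 2 (r s - 1) (1 - u.v)], which is nonnegative. *)
Lemma enorm_sphere_le_scale (u v : 'rV[R]_n) (r s : R) :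
  sphere R n u -> sphere R n v -> (1 <= r)%R -> (1 <= s)%R ->
  (enorm (u - v) <= enorm (r *: u - s *: v))%R.
Proof.
move=> u1 v1 r1 s1; rewrite ler_wsqrtr//.
have E (a b : R) : dotv (a *: u - b *: v) (a *: u - b *: v) =
    (a ^+ 2 + b ^+ 2 - 2 * a * b * dotv u v)%R.
  rewrite !(dotvDl, dotvDr, dotvNl, dotvNr, dotvZl, dotvZr).
  by rewrite (sphere_dotv u1) (sphere_dotv v1) (dotvC v u); ring.
have := E 1%R 1%R; rewrite !scale1r => E1; rewrite E1 E.
have := dotvv_ge0 (u - v); rewrite E1 => uv.
have rs1 : (1 <= r * s)%R by rewrite -[1%R]mulr1 ler_pM.
have : (0 <= (r * s - 1) * (1 - dotv u v))%R.
  by apply: mulr_ge0; rewrite subr_ge0//; lra.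
have := sqr_ge0 (r - s)%R.
by nra.
Qed.

Lemma unit_grid_cell N (x : R) : (0 <= x <= N.+1%:R)%R ->
  exists a : 'I_N.+1, (a%:R <= x <= a%:R + 1)%R.
Proof.
move=> /andP[x0]; rewrite le_eqVlt => /predU1P[->|xN].
  (* The right end point belongs to the last cell. *)
  by exists ord_max; rewrite /= -natr1; apply/andP; split; lra.
have tN : (Num.truncn x < N.+1)%N by rewrite truncn_lt_nat.
exists (Ordinal tN) => /=; have /andP[-> h] := truncn_itv x0.
by rewrite natr1 ltW.
Qed.

(* The cells of a grid on the faces of the cube [-1, 1]^n project radially to
   pieces of the sphere of diameter O(1/N). *)
Lemma hausdorff_sphere_lty : hausdorff n.-1 (sphere R n) < +oo.
Proof.
pose m := n.-1.
(* There are [2 n (N+1)^m] cells of diameter at most [dN = 2 n / (N+1)], each of weight at most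
   [unit_ball_volume R m * (n / (N+1))^m]; the powers of [N+1] cancel. *)
pose B : R := ((2 * n)%:R * (unit_ball_volume R m * n%:R ^+ m))%R.
apply: (@le_lt_trans _ _ B%:E); last exact: ltry.
apply: ge_ereal_sup => _ [d /= d0 <-].
pose N := Num.truncn (2 * n%:R / d)%R.
have N0 : (0 < N.+1%:R :> R)%R by rewrite ltr0n.
pose dN : R := (n%:R * (2 / N.+1%:R))%R.
have dN0 : (0 <= dN)%R by rewrite mulr_ge0// divr_ge0.
have dNd : (dN <= d)%R.
  have -> : dN = (2 * n%:R / N.+1%:R)%R by rewrite /dN; ring.
  rewrite ler_pdivrMr// (mulrC d) -ler_pdivrMr// ltW//.
  exact: truncnS_gt.
apply: le_trans (hausdorff_content_anti m (sphere R n) dNd) _.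
pose T : finType := (bool * 'I_n * {ffun 'I_m -> 'I_N.+1})%type.
(* The sign [t.1.1] and the coordinate [t.1.2] select a face of the cube, and [t.2] a cell of it;
   [r] scales [u] onto the face. *)
pose G (t : T) : set 'rV[R]_n := [set u | sphere R n u /\ exists r : R,
  [/\ (1 <= r)%R, (r * u 0 t.1.2 = (-1) ^+ t.1.1)%R &
   forall k : 'I_m, let a : R := (t.2 k : nat)%:R in
     (-1 + a * (2 / N.+1%:R) <= r * u 0%R (lift t.1.2 k) <= -1 + (a + 1) * (2 / N.+1%:R))%R]].
have GdN t : ediam (G t) <= dN%:E.
  apply: ge_ereal_sup => _ [[u v] [[/= u1 [r [r1 ri rk]]] [v1 [s [s1 si sk]]]] <-].
  rewrite lee_fin; apply: le_trans (enorm_sphere_le_scale u1 v1 r1 s1) _.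
  apply: enorm_le_coord; first by rewrite divr_ge0.
  move=> i; rewrite !mxE; case: (unliftP t.1.2 i) => [k ->|->].
    have := rk k; have := sk k; rewrite /= => /andP[h1 h2] /andP[h3 h4].
    move: h1 h2 h3 h4; move: (2 / _)%R ((t.2 k)%:R : R)%R => w a h1 h2 h3 h4.
    by rewrite ler_norml; apply/andP; split; lra.
  by rewrite ri si subrr normr0 divr_ge0.
have cov : sphere R n `<=` \bigcup_t G t.
  move=> u u1.
  have un0 : mx_norm u != 0%R by apply: contra (sphere_neq0 u1) => /eqP /mx_norm_eq0 ->.
  (* A coordinate of largest absolute value: dividing by it puts [u] on a face of the cube. *)
  have [[j i] /= uE] := mx_norm_neq0 un0; rewrite (ord1 j) in uE.
  have uE' : (`|u| = `|u 0 i|)%R by exact: uE.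
  have ui0 : (0 < `|u 0%R i|)%R by rewrite -uE' normr_gt0 sphere_neq0.
  pose r : R := (`|u 0%R i|^-1)%R.
  have r0 : (0 < r)%R by rewrite invr_gt0.
  have ruj j' : (-1 <= r * u 0%R j' <= 1)%R.
    rewrite -ler_norml normrM gtr0_norm// /r mulrC ler_pdivrMr// mul1r -uE'.
    exact: coord_le_norm.
  have cell (k : 'I_m) : exists a : 'I_N.+1,
     (-1 + a%:R * (2 / N.+1%:R) <= r * u 0%R (lift i k) <= -1 + (a%:R + 1) * (2 / N.+1%:R))%R.
    have := ruj (lift i k); set y := (r * _)%R => /andP[y1 y2].
    have [|a /andP[a1 a2]] := @unit_grid_cell N ((y + 1) * (N.+1%:R / 2))%R.
      apply/andP; split; first by apply: mulr_ge0; [lra|rewrite divr_ge0].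
      rewrite mulrCA -[leRHS]mulr1 ler_pM2l//; lra.
    exists a.
    have N2 : (0 < 2 / N.+1%:R :> R)%R by rewrite divr_gt0.
    have yE : (y = -1 + ((y + 1) * (N.+1%:R / 2)) * (2 / N.+1%:R))%R.
      by move: (N.+1%:R : R)%R N0 => w w0; field; rewrite gt_eqF.
    by rewrite yE !lerD2l !ler_pM2r// a1 a2.
  have [f fP] := fin_all_exists cell.
  exists ((u 0%R i < 0)%R, i, finfun f) => //; split=> //; exists r; split=> /=.
  - by rewrite /r invf_ge1// -uE' norm_sphere_le1.
  - rewrite /r; have [ui|ui] := ltP (u 0%R i) 0%R.
      by rewrite ltr0_norm// invrN mulNr mulVf ?expr1// lt_eqF.
    by rewrite ger0_norm// mulVf ?expr0// -normr_gt0.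
  - by move=> k; rewrite ffunE.
apply: le_trans (hausdorff_content_finite_cover m dN0 cov GdN) _.
rewrite lee_fin le_eqVlt; apply/orP; left; apply/eqP.
rewrite !card_prod card_bool card_ord card_ffun !card_ord natrM natrX /B.
rewrite /dN -!mulrA; congr (_ * _)%R; rewrite mulrCA; congr (_ * _)%R.
rewrite -exprMn; congr (_ ^+ _)%R.
by move: (N.+1%:R : R)%R N0 => w w0; field; rewrite gt_eqF.
Qed.

(* The chart [u |-> c u_j / u_i] inverts radial projection from the affine
   hyperplane [x_i = c = (u0)_i]. *)
Lemma hausdorff_sphere_gt0 (g : 'rV[R]_n -> R) (C : R) (u0 : 'rV[R]_n) :
  (0 < C)%R -> (forall x y, (`|g x - g y| <= C * `|x - y|)%R) ->
  (forall (t : R) x, (0 <= t)%R -> (g (t *: x) = t * g x)%R) ->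
  sphere R n u0 -> (0 < g u0)%R ->
  0 < hausdorff n.-1 (sphere R n `&` [set u | (0 < g u)%R]).
Proof.
move=> C0 glip gZ u01 gu0.
have un0 : mx_norm u0 != 0%R by apply: contra (sphere_neq0 u01) => /eqP /mx_norm_eq0 ->.
have [[j i] /= uE] := mx_norm_neq0 un0; rewrite (ord1 j) in uE.
set c := u0 0%R i.
have c0 : c != 0%R by rewrite /c; move: un0; rewrite uE normr_eq0.
have cp : (0 < `|c|)%R by rewrite normr_gt0.
have n0 : (0 < n)%N by exact: leq_ltn_trans (leq0n _) (ltn_ord i).
(* Side of a box at [u0] in the hyperplane: [C * e < g u0] keeps [g] positive on it, and [e <= 1]
   bounds its points in sup norm by 2. *)
pose e : R := Num.min 1%R (g u0 / (2 * C))%R.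
have e0 : (0 < e)%R by rewrite lt_min ltr01 divr_gt0// mulr_gt0.
have e1 : (e <= 1)%R by rewrite ge_min lexx.
have eC : (C * e < g u0)%R.
  apply: (@le_lt_trans _ _ (C * (g u0 / (2 * C)))%R).
    by rewrite ler_pM2l// ge_min lexx orbT.
  have -> : (C * (g u0 / (2 * C)) = g u0 / 2)%R by field; rewrite gt_eqF.
  by lra.
(* Points of the box have [i]-th coordinate [c] and Euclidean norm at most [2 n], so after
   normalization this coordinate is at least [b] in absolute value. On [A] the chart then divides
   safely. *)
pose b : R := (`|c| / (n%:R * 2))%R.
have nR0 : (0 < n%:R * 2 :> R)%R by rewrite mulr_gt0// ltr0n.
have b0 : (0 < b)%R by rewrite divr_gt0.
pose A := sphere R n `&` [set u | (0 < g u)%R] `&` [set u | (b <= `|u 0%R i|)%R].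
apply: (@lt_le_trans _ _ (hausdorff n.-1 A)); last by apply: le_hausdorff => x [].
pose phi (u : 'rV[R]_n) (k : 'I_n.-1) : R :=
  ((c * (u 0 (lift i k) / u 0 i) - u0 0 (lift i k)) / e)%R.
apply: (@hausdorff_gt0_chart _ _ _ A phi (`|c| * (2 / b ^+ 2) / e)%R).
- by rewrite divr_gt0// mulr_gt0// divr_gt0// exprn_gt0.
- move=> x y k [[x1 _] /= bx] [[y1 _] /= yb].
  set l := lift i k.
  have x0 : x 0%R i != 0%R by rewrite -normr_gt0 (lt_le_trans b0).
  have y0 : y 0%R i != 0%R by rewrite -normr_gt0 (lt_le_trans b0).
  have -> : (phi x k - phi y k = c / e * ((x 0 l - y 0 l) * y 0 i + y 0 l * (y 0 i - x 0 i))
       / (x 0 i * y 0 i))%R.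
    by rewrite /phi -/l; field; rewrite x0 y0 gt_eqF.
  have D k' : (`|x 0 k' - y 0 k'| <= enorm (x - y))%R.
    by have := coord_le_enorm (x - y) k'; rewrite !mxE.
  have Y k' : (`|y 0 k'| <= 1)%R.
    exact: le_trans (coord_le_norm y k') (norm_sphere_le1 y1).
  have num : (`|(x 0 l - y 0 l) * y 0 i + y 0 l * (y 0 i - x 0 i)| <= 2 * enorm (x - y))%R.
    apply: le_trans (ler_normD _ _) _; rewrite !normrM.
    have := ler_pM (normr_ge0 _) (normr_ge0 _) (D l) (Y i).
    have := ler_pM (normr_ge0 _) (normr_ge0 _) (Y l) (D i).
    by rewrite (distrC (y 0%R i)) mul1r mulr1; lra.
  have den : (b ^+ 2 <= `|x 0 i * y 0 i|)%R.
    by rewrite normrM expr2 ler_pM// ltW.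
  rewrite !normrM !normfV (gtr0_norm e0).
  have -> : (`|c| * (2 / b ^+ 2) / e * enorm (x - y) =
     `|c| / e * (2 * enorm (x - y)) * (b ^+ 2)^-1)%R.
    by field; rewrite !gt_eqF.
  apply: ler_pM.
  + by rewrite mulr_ge0// divr_ge0// ltW.
  + by rewrite invr_ge0.
  + by rewrite ler_pM2l// divr_gt0.
  + have b20 : (0 < b ^+ 2)%R by rewrite exprn_gt0.
    by rewrite lef_pV2 ?posrE ?(lt_le_trans b20 den).
- move=> y y01.
  (* Preimage of [y] under the chart: shift [u0] by [e y] within the hyperplane, then project to the
     sphere. *)
  pose z : 'rV[R]_n := (\row_j if unlift i j is Some k then e * y k else 0)%R.
  pose x := (u0 + z)%R.
  have xi : x 0%R i = c by rewrite !mxE unlift_none addr0.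
  have xk k : (x 0 (lift i k) = u0 0 (lift i k) + e * y k)%R.
    by rewrite !mxE liftK.
  have ze : (`|z| <= e)%R.
    apply: norm_le_coord; first exact: ltW.
    move=> j'; rewrite mxE; case: unliftP => [k _|_]; last by rewrite normr0 ltW.
    have /andP[yk0 yk1] := y01 k.
    by rewrite ger0_norm ?mulr_ge0// ?(ltW e0)// ler_piMr// ltW.
  have x0 : x != 0%R.
    by apply: contra c0 => /eqP x0; rewrite -xi x0 mxE.
  have ex0 := enorm_gt0 x0.
  have gx : (0 < g x)%R.
    have := glip u0 x; rewrite opprD addNKr normrN => h.
    have h2 : (C * `|z| <= C * e)%R by rewrite ler_pM2l.
    have := le_trans (ler_norm _) (le_trans h h2).
    by lra.
  have exn : (enorm x <= n%:R * 2)%R.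
    apply: enorm_le_coord => // k'; apply: le_trans (coord_le_norm x k') _.
    apply: le_trans (ler_normD _ _) _.
    by have := norm_sphere_le1 u01; lra.
  exists ((enorm x)^-1 *: x)%R.
    split; first split; first exact: sphere_normalize.
      by rewrite /= gZ ?invr_ge0 ?(ltW ex0)// mulr_gt0// invr_gt0.
    rewrite /= mxE xi normrM gtr0_norm ?invr_gt0// /b mulrC.
    by rewrite ler_pM2r// lef_pV2// posrE.
  move=> k; have U j' : (((enorm x)^-1 *: x) 0 j' = (enorm x)^-1 * x 0 j')%R.
    by rewrite mxE.
  rewrite /phi !U xi xk; field.
  by rewrite c0 !gt_eqF.
Qed.

Lemma caratheodory_lipschitz_measurable m (C : R) (f : 'rV[R]_n -> R) :
  (0 < C)%R -> (forall x y, (`|f x - f y| <= C * enorm (x - y))%R) ->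
  measurable_fun [set: caratheodory_type (@hausdorff R n m)] f.
Proof.
move=> C0 fC; apply: (measurability _ (RGenOInfty.measurableE R)) => //.
move=> _ [_ [a ->] <-]; rewrite setTI preimage_itvoy.
have -> : [set x | (a < f x)%R] = ~` [set x | (f x <= a)%R].
  by apply/seteqP; split=> x /=; rewrite ltNge => /negP.
apply: measurableC; exact: (lipschitz_caratheodory _ _ C0 fC).
Qed.

(** The coordinates are Lipschitz, hence measurable, and the sphere is a level set of the sum of
    their squares. *)
Lemma sphere_caratheodory_measurable m :
  measurable (sphere R n : set (caratheodory_type (@hausdorff R n m))).
Proof.
have mc (i : 'I_n) : measurable_fun [set: caratheodory_type (@hausdorff R n m)]
    (fun x : 'rV[R]_n => x 0%R i).
  apply: (@caratheodory_lipschitz_measurable m 1%R) => // x y.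
  by rewrite mul1r; have := coord_le_enorm (x - y) i; rewrite !mxE.
have md : measurable_fun [set: caratheodory_type (@hausdorff R n m)]
    (fun x : 'rV[R]_n => dotv x x).
  rewrite /dotv; apply: measurable_sum => i.
  by apply: measurable_funM; exact: mc.
have -> : sphere R n = setT `&` (fun x : 'rV[R]_n => dotv x x) @^-1` [set 1%R].
  by rewrite setTI; apply/seteqP; split=> x /sphereP.
by apply: md => //; exact: measurable_set1.
Qed.

End SphereMeasure.

(** * Comparison of dual curvature measures *)

Section StrictIntegral.
Local Open Scope ereal_scope.

(** The integral of [g] exceeds the finite integral of [f] by that of [g - f]. If the latter
    vanished, [g - f] would vanish almost everywhere on [D], against [0 < mu D]. *)
Lemma ge0_lt_integral d (T : measurableType d) (R : realType)
    (mu : {measure set T -> \bar R}) (D : set T) (f g : T -> R) :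
  measurable D -> measurable_fun D f -> measurable_fun D g ->
  (forall x, D x -> (0 <= f x < g x)%R) ->
  \int[mu]_(x in D) (f x)%:E < +oo -> 0 < mu D ->
  \int[mu]_(x in D) (f x)%:E < \int[mu]_(x in D) (g x)%:E.
Proof.
move=> mD mf mg fg foo muD.
have h0 x : D x -> (0 <= g x - f x)%R.
  by move=> /fg /andP[_ /ltW]; rewrite subr_ge0.
have -> : \int[mu]_(x in D) (g x)%:E =
    \int[mu]_(x in D) ((f x)%:E + (g x - f x)%:E).
  by apply: eq_integral => x _; rewrite -EFinD addrCA subrr addr0.
have mh : measurable_fun D (fun x => (g x - f x)%:E).
  by apply/measurable_EFinP; exact: measurable_funB.
have mf' : measurable_fun D (fun x => (f x)%:E) by exact/measurable_EFinP.
have f0' x : D x -> 0 <= (f x)%:E by move=> /fg /andP[h _]; rewrite lee_fin.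
have h0' x : D x -> 0 <= (g x - f x)%:E by move=> Dx; rewrite lee_fin h0.
rewrite (ge0_integralD mu mD f0' mf' h0' mh).
have f0 : 0 <= \int[mu]_(x in D) (f x)%:E.
  by apply: integral_ge0 => x /fg /andP[h _]; rewrite lee_fin.
rewrite lteDl ?ge0_fin_numE// lt_neqAle integral_ge0 ?andbT; last first.
  by move=> x Dx; rewrite lee_fin h0.
apply/negP => /eqP/esym int0.
have := (ae_eq_integral_abs mu mD mh).1.
have -> : \int[mu]_(x in D) `|(g x - f x)%:E| = 0.
  rewrite -int0; apply: eq_integral => x /set_mem Dx.
  by rewrite gee0_abs// lee_fin h0.
move=> /(_ erefl) ae0.
suff : mu D = 0 by move=> D0; rewrite D0 ltxx in muD.
apply: measure_negligible => //; apply: negligibleS ae0 => x Dx /= /(_ Dx) [] h.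
by have /andP[_] := fg x Dx; rewrite -subr_gt0 h ltxx.
Qed.

(** The strict inequality takes place on the measurable set [U]; the passages from [A] to [U] and
    from [U] to [B] are monotonicity. In the application [A] and [B] are reverse radial Gauss
    images. *)
Lemma lt_integral_sandwich d (T : measurableType d) (R : realType)
    (mu : {measure set T -> \bar R}) (A U B : set T) (f g : T -> R) (M : R) :
  A `<=` U -> U `<=` B -> measurable U -> measurable_fun U f -> measurable_fun U g ->
  (forall x, (0 <= f x)%R) -> (forall x, (0 <= g x)%R) ->
  (forall x, U x -> (f x < g x)%R) -> (forall x, U x -> (f x <= M)%R) ->
  0 < mu U -> mu U < +oo ->
  \int[mu]_(x in A) (f x)%:E < \int[mu]_(x in B) (g x)%:E.
Proof.
move=> AU UB mU mf mg f0 g0 fg fM muU0 muUoo.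
have [x Ux] : U !=set0.
  by apply/set0P/eqP => U0; move: muU0; rewrite U0 measure0 ltxx.
have M0 : (0 <= M)%R by apply: le_trans (f0 x) (fM x Ux).
apply: (@le_lt_trans _ _ (\int[mu]_(x in U) (f x)%:E)).
  by apply: ge0_subset_le_integral => // y _; rewrite lee_fin.
apply: (@lt_le_trans _ _ (\int[mu]_(x in U) (g x)%:E)); last first.
  by apply: ge0_subset_le_integral => // y _; rewrite lee_fin.
apply: ge0_lt_integral => // [y Uy|]; first by rewrite f0 fg.
apply: (@le_lt_trans _ _ (\int[mu]_(x in U) (cst M%:E x))).
  by apply: ge0_subset_le_integral => // y Uy; rewrite lee_fin// fM.
by rewrite integral_cst// lte_mul_pinfty// lee_fin.
Qed.

End StrictIntegral.

(** * Inclusion of bodies from equality of dual curvature measures *)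

Section Uniqueness.
Context (R : realType) (n : nat).
Implicit Types K L : set 'rV[R]_n.

Lemma lipschitz_norm_enorm (f : 'rV[R]_n -> R) (C : R) : 0 < C ->
  (forall x y, `|f x - f y| <= C * `|x - y|) ->
  forall x y, `|f x - f y| <= C * enorm (x - y).
Proof.
move=> C0 fC x y; apply: le_trans (fC x y) _.
by rewrite ler_pM2l// norm_le_enorm.
Qed.

Lemma lt_support_open K L : convex_body K -> K° 0 -> convex_body L -> L° 0 ->
  open [set v | support_fun L v < support_fun K v].
Proof.
move=> bK oK bL oL; have [C C0 lipK] := support_fun_lipschitz bK oK.
have [D D0 lipL] := support_fun_lipschitz bL oL.
rewrite openE => v /= LKv; apply/nbhs_ballP.
have CD0 : 0 < C + D by rewrite addr_gt0.
exists ((support_fun K v - support_fun L v) / (C + D)) => /=.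
  by rewrite divr_gt0// subr_gt0.
move=> w; rewrite -ball_normE /= ltr_pdivlMr// => vw.
have := lipK v w; have := lipL v w; rewrite !ler_norml => /andP[h1 h2] /andP[h3 h4].
move: vw; rewrite mulrDr; lra.
Qed.

(** Turns a negative power of the radial function into a positive power of the gauge, which is
    measurable, bounded on the sphere and monotone in the gauge. *)
Lemma radial_fun_powR K (q : R) u : convex_body K -> K° 0 -> sphere R n u ->
  radial_fun K u `^ q = gauge K u `^ (- q).
Proof.
move=> bK oK u1; rewrite (radial_fun_gauge bK oK (sphere_neq0 u1)).
by rewrite -powR_inv1 ?gauge_ge0// -powRrM mulN1r.
Qed.

Lemma measurable_gauge m K : convex_body K -> K° 0 ->
  measurable_fun [set: caratheodory_type (@hausdorff R n m)] (gauge K).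
Proof.
move=> bK oK; have [C C0 lip] := gauge_lipschitz bK oK.
exact: caratheodory_lipschitz_measurable C0 (lipschitz_norm_enorm C0 lip).
Qed.

Lemma measurable_radial_powR m (q : R) (D : set (caratheodory_type (@hausdorff R n m))) K :
  convex_body K -> K° 0 -> measurable D -> D `<=` sphere R n ->
  measurable_fun D (fun u : caratheodory_type (@hausdorff R n m) => radial_fun K u `^ q).
Proof.
move=> bK oK mD DS.
have := measurableT_comp (@measurable_powR R (- q)) (measurable_gauge (m := m) bK oK).
move=> /(measurable_funTS (D := D)).
apply: eq_measurable_fun => u /set_mem Du.
by rewrite /= -(radial_fun_powR q bK oK (DS u Du)).
Qed.

Lemma gauge_bounded_sphere K : convex_body K -> K° 0 ->
  exists C : R, forall u, sphere R n u -> gauge K u <= C.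
Proof.
move=> bK oK; have [C C0 lip] := gauge_lipschitz bK oK; exists C => u u1.
have := lip u 0; rewrite (sublinear0 (gauge_sublinear bK oK)) !subr0.
rewrite ger0_norm ?gauge_ge0// => /le_trans; apply.
by rewrite ler_piMr ?(ltW C0)// norm_sphere_le1.
Qed.

Lemma mule_invn_inj : (0 < n)%N -> injective (fun x : \bar R => (n%:R^-1)%:E * x)%E.
Proof.
move=> n0 x y /(congr1 (fun z => n%:R%:E * z)%E).
by rewrite !muleA -EFinM divff ?pnatr_eq0 -?lt0n// !mul1e.
Qed.

Lemma dual_curvature_measure_sub (q : R) K L : (0 < n)%N -> q < 0 ->
  convex_body K -> K° 0 -> convex_body L -> L° 0 ->
  (forall eta, borel_sphere R n eta ->
    dual_curvature_measure q K eta = dual_curvature_measure q L eta) ->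
  K `<=` L.
Proof.
move=> n0 q0 bK oK bL oL eqC x Kx; apply: contrapT => nLx.
pose mu := hausdorff_measure R n n.-1.
pose T := caratheodory_type (@hausdorff R n n.-1).
have gx : 0 < gauge L x - gauge K x.
  have : gauge K x <= 1 by apply/gauge_le1P.
  have : ~ gauge L x <= 1 by move/(gauge_le1P bL oL).
  by move=> /negP; rewrite -ltNge; lra.
have x0 : x != 0.
  apply: contraPneq nLx => ->; apply; exact: interior_subset.
have [CK CK0 lipK] := gauge_lipschitz bK oK.
have [CL CL0 lipL] := gauge_lipschitz bL oL.
(* On the sphere, [0 < g u] says that [K] reaches farther than [L] in direction [u]. The normalized
   [x] is such a direction. *)
pose g y := gauge L y - gauge K y.
have glip y z : `|g y - g z| <= (CL + CK) * `|y - z|.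
  have -> : g y - g z = (gauge L y - gauge L z) - (gauge K y - gauge K z).
    by rewrite /g; lra.
  by apply: le_trans (ler_normB _ _) _; rewrite mulrDl lerD.
have gZ (t : R) y : 0 <= t -> g (t *: y) = t * g y.
  by move=> t0; rewrite /g !gaugeZ// mulrBr.
pose U : set T := sphere R n `&` [set u | 0 < g u].
have muU0 : (0 < mu U)%E.
  apply: (@hausdorff_sphere_gt0 _ _ g (CL + CK) ((enorm x)^-1 *: x)) => //.
  - by rewrite addr_gt0.
  - exact: sphere_normalize.
  - by rewrite gZ ?invr_ge0 ?enorm_ge0// mulr_gt0// invr_gt0 enorm_gt0.
have muUoo : (mu U < +oo)%E.
  apply: le_lt_trans (hausdorff_sphere_lty R n).
  by apply: le_hausdorff => u [].
have mgK := measurable_gauge (m := n.-1) bK oK.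
have mgL := measurable_gauge (m := n.-1) bL oL.
have mU : measurable U.
  apply: measurableI; first exact: sphere_caratheodory_measurable.
  rewrite -[X in measurable X]setTI.
  have -> : [set u | 0 < g u] = g @^-1` `]0, +oo[.
    by apply/seteqP; split=> u /=; rewrite in_itv/= andbT.
  by apply: (measurable_funB mgL mgK) => //; exact: measurable_itv.
pose eta := [set v | support_fun L v < support_fun K v] `&` sphere R n.
have Beta : borel_sphere R n eta.
  apply: sub_sigma_algebra; exists [set v | support_fun L v < support_fun K v] => //.
  exact: lt_support_open.
have AU : reverse_radial_gauss_image K eta `<=` U.
  move=> u [u1 [v [LKv v1] vn]]; split=> //=; rewrite /g subr_gt0.
  exact: (lt_gauge_of_normal bK oK bL oL u1 vn).
have UB : U `<=` reverse_radial_gauss_image L eta.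
  move=> u [u1 /=]; rewrite /g subr_gt0 => KLu; split=> //.
  have [v vn] := outer_unit_normal_exists bL oL u1.
  exists v => //; split; last by case: vn.
  exact: (lt_support_of_normal bK oK bL oL u1 vn).
(* Bounds the integrand for [K] on [U], which makes its integral finite as strictness requires. *)
have [C gC] := gauge_bounded_sphere bK oK.
have US : U `<=` sphere R n by move=> u [].
have ltI := @lt_integral_sandwich _ _ _ mu _ U _ (fun u => radial_fun K u `^ q)
  (fun u => radial_fun L u `^ q) (C `^ (- q)) AU UB mU
  (measurable_radial_powR q bK oK mU US) (measurable_radial_powR q bL oL mU US)
  (fun u => powR_ge0 _ _) (fun u => powR_ge0 _ _).
have q0' : 0 < - q by rewrite oppr_gt0.
have radlt u : U u -> radial_fun K u `^ q < radial_fun L u `^ q.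
  move=> [u1 ug]; rewrite (radial_fun_powR q bK oK u1) (radial_fun_powR q bL oL u1).
  apply: (gt0_ltr_powR q0'); rewrite ?nnegrE.
  - exact: gauge_ge0.
  - exact: gauge_ge0.
  - by move: ug; rewrite /= /g subr_gt0.
have radle u : U u -> radial_fun K u `^ q <= C `^ (- q).
  move=> [u1 _]; rewrite (radial_fun_powR q bK oK u1).
  have Cu := gC u u1; have g0 := gauge_ge0 oK u.
  apply: (ge0_ler_powR (ltW q0')); rewrite ?nnegrE.
  - exact: g0.
  - exact: le_trans g0 Cu.
  - exact: Cu.
have /lt_eqF/eqP := ltI radlt radle muU0 muUoo; apply.
exact: (mule_invn_inj n0 (eqC eta Beta)).
Qed.

End Uniqueness.

Theorem mainTheorem2 (R : realType) (n : nat) (n_gt0 : (0 < n)%N)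
  (q : R) (q_lt0 : q < 0) (K L : set 'rV[R]_n)
  (bodyK : convex_body K) (originK : K° 0)
  (bodyL : convex_body L) (originL : L° 0)
  (eqC : forall eta : set 'rV[R]_n, borel_sphere R n eta ->
    dual_curvature_measure q K eta = dual_curvature_measure q L eta) :
  K = L.
Proof.
apply/seteqP; split.
  exact: (dual_curvature_measure_sub n_gt0 q_lt0 bodyK originK bodyL originL eqC).
apply: (dual_curvature_measure_sub n_gt0 q_lt0 bodyL originL bodyK originK) => eta Beta.
exact: esym (eqC eta Beta).
Qed.
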